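(* Suppose $\tau\le m/n\le1/\tau$ for some $\tau\in(0,1)$. Let $A_0,B_0\in\mathbb{R}^{m\times n}$ be two random matrices with independent entries, $\mathbb{E}A_{0,ij}^\ell=\mathbb{E}B_{0,ij}^\ell=\mathbf 1_{\ell=2}$ for all $i\in[m],j\in[n],\ell=1,2$, and $M_0\equiv\max_{i\in[m],j\in[n]}(\mathbb{E}|A_{0,ij}|^3+\mathbb{E}|B_{0,ij}|^3)<\infty$. Let $A\equiv A_0/\sqrt m$, $B\equiv B_0/\sqrt m$, let $Q_n:\mathbb{R}^m\times\mathbb{R}^n\to\mathbb{R}$ be measurable, and let $$X_n(u,w;A)\equiv\frac1mu^\top Aw+Q_n(u,w).$$ Then there exists $C_0=C_0(\tau,M_0)>0$ such that for any measurable subsets $\mathcal{S}_u\subset[-L_u,L_u]^m$, $\mathcal{S}_w\subset[-L_w,L_w]^n$ with $L_u,L_w\ge1$, and any $\mathsf g\in C^3(\mathbb{R})$, $$\Big|\mathbb{E}\,\mathsf g\Big(\max_{u\in\mathcal{S}_u}\min_{w\in\mathcal{S}_w}X_n(u,w;A)\Big)-\mathbb{E}\,\mathsf g\Big(\max_{u\in\mathcal{S}_u}\min_{w\in\mathcal{S}_w}X_n(u,w;B)\Big)\Big|\le C_0K_{\mathsf g}\,\mathsf r_n,$$ $$\mathsf r_n\equiv\inf_{0<\delta\le n^{-1}}\Big\{\mathscr M_{Q_n}(L,\delta)+\frac{L^2\log^{2/3}(L/\delta)}{n^{1/6}}\Big\}.$$ Here $K_{\mathsf g}\equiv1+\max_{\ell\in\{0,1,2,3\}}\lVert\mathsf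 g^{(\ell)}\rVert_\infty$, $L\equiv L_u+L_w$. Consequently, $$\mathbb{P}\Big(\max_{u\in\mathcal{S}_u}\min_{w\in\mathcal{S}_w}X_n(u,w;A)>z+3\epsilon\Big)\le\mathbb{P}\Big(\max_{u\in\mathcal{S}_u}\min_{w\in\mathcal{S}_w}X_n(u,w;B)>z+\epsilon\Big)+C_1(1\vee\epsilon^{-3})\,\mathsf r_n$$ holds for any $z\in\mathbb{R}$ and $\epsilon>0$, where $C_1>0$ is an absolute multiple of $C_0$. The conclusion continues to hold both when (i) max-min is flipped to min-max, and (ii) there exists some set $S\subset[m]\times[n]$ such that $A_{ij}=B_{ij}=0$ for $(i,j)\in S$ (the moment requirements on $A_0,B_0$ then being imposed for $(i,j)\notin S$).
   Context: Notation: $[m]=\{1,\dots,m\}$; $a\vee b=\max\{a,b\}$; $\lVert\cdot\rVert_\infty$ is the sup norm of functions or vectors. $\mathscr M_{Q_n}(L,\delta)\equiv\sup|Q_n(u,w)-Q_n(u',w')|$, with the supremum over all $u,u'\in[-L,L]^m$, $w,w'\in[-L,L]^n$ such that $\lVert u-u'\rVert_\infty\vee\lVert w-w'\rVert_\infty\le\delta$. *)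

(* Defs.v *)
From HB Require Import structures.
From mathcomp Require Import all_boot all_order all_algebra.
From mathcomp Require Import all_classical all_reals all_analysis.

Set Implicit Arguments.
Unset Strict Implicit.
Unset Printing Implicit Defensive.

Import Order.TTheory GRing.Theory Num.Theory.
Import numFieldNormedType.Exports.

Local Open Scope classical_set_scope.
Local Open Scope ring_scope.

(* Matrices carry a topology in the library but no sigma-algebra: R^m is given
   its Borel sigma-algebra, and R^m * R^n the product of these (which is again
   the Borel one, the spaces being second countable). *)
Definition borel (T : ptopologicalType) := g_sigma_algebraType (@open T).

Definition borel_set (T : ptopologicalType) (A : set T) : Prop :=
  (@open T).-sigma.-measurable A.

Definition independent_RVs (d : measure_display) (T : measurableType d)
    (R : realType) (P : probability T R) (I : finType)
    (X : I -> {RV P >-> R}) : Prop :=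
  forall (J : {set I}) (E : I -> set R), (forall i, measurable (E i)) ->
    P (\bigcap_(i in [set` J]) (X i @^-1` E i)) =
    (\big[*%E/1]_(i in J) P (X i @^-1` E i))%E.

Section RandomMatrix.
Context (d : measure_display) (T : measurableType d) (R : realType).
Context (P : probability T R) (m n : nat).
Implicit Types A B : 'I_m -> 'I_n -> {RV P >-> R}.

Definition independent_entries A : Prop :=
  independent_RVs (fun ij : 'I_m * 'I_n => A ij.1 ij.2).

(* Entries indexed by S vanish; the others are centered with unit variance. *)
Definition standardized_off (S : {set 'I_m * 'I_n}) A : Prop :=
  (forall i j, (i, j) \in S -> {ae P, forall t, A i j t = 0}) /\
  (forall i j, (i, j) \notin S -> forall l : nat, l \in [:: 1%N; 2%N] ->
    ('E_P[(fun t => (A i j t ^+ l)%R)] = ((l == 2%N)%:R)%:E)%E).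

(* All terms are nonnegative, so 0 is the right value for an empty maximum. *)
Definition max_third_moment (S : {set 'I_m * 'I_n}) A B : \bar R :=
  (\big[maxe/0]_(ij : 'I_m * 'I_n | ij \notin S)
    ('E_P[(fun t => (`|A ij.1 ij.2 t| ^+ 3)%R)] +
     'E_P[(fun t => (`|B ij.1 ij.2 t| ^+ 3)%R)]))%E.

Definition scaled_mx A (t : T) : 'M[R]_(m, n) :=
  (Num.sqrt m%:R)^-1 *: \matrix_(i, j) A i j t.

End RandomMatrix.

Section Objective.
Context (R : realType) (m n : nat).
Implicit Types (Q : 'cV[R]_m -> 'cV[R]_n -> R) (L delta : R).

Definition Xn Q (A : 'M[R]_(m, n)) (u : 'cV[R]_m) (w : 'cV[R]_n) : R :=
  m%:R^-1 * (u^T *m A *m w) ord0 ord0 + Q u w.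

Definition jointly_measurable Q : Prop :=
  measurable_fun [set: borel 'cV[R]_m * borel 'cV[R]_n]
    (fun uw : borel 'cV[R]_m * borel 'cV[R]_n => Q uw.1 uw.2 : R).

Definition cube (k : nat) L : set 'cV[R]_k :=
  [set v : 'cV[R]_k | forall i, - L <= v i ord0 <= L].

(* The norm of a matrix is the maximum of the absolute values of its entries. *)
Definition osc Q L delta : \bar R :=
  ereal_sup [set r | exists u u' w w',
    [/\ cube L u /\ cube L u', cube L w /\ cube L w',
        Num.max `|u - u'| `|w - w'| <= delta &
        r = `|Q u w - Q u' w'|%:E]].

Definition rate Q L : \bar R :=
  ereal_inf [set
    (osc Q L delta +
      (L ^+ 2 * ln (L / delta) `^ (2 / 3) / n%:R `^ (1 / 6))%:E)%E
    | delta in [set delta | 0 < delta <= n%:R^-1]].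

End Objective.

(* derive1 is defined by a limit even where no derivative exists, so
   derivability has to be required separately. *)
Definition C3 (R : realType) (g : R -> R) : Prop :=
  (forall l : nat, (l < 3)%N -> forall x, derivable (derive1n l g) x 1) /\
  (forall l : nat, (l <= 3)%N -> continuous (derive1n l g)).

Definition sup_norm (R : realType) (f : R -> R) : \bar R :=
  ereal_sup (range (fun x => `|f x|%:E)).

Definition Kg (R : realType) (g : R -> R) : \bar R :=
  (1 + \big[maxe/0]_(l < 4) sup_norm (derive1n l g))%E.

(* Maxima and minima need not be attained and are read as suprema and infima
   in the extended reals. *)
Section MaxMin.
Context (R : realType) (U W : Type) (Su : set U) (Sw : set W).
Implicit Type F : U -> W -> R.

Definition max_min F : \bar R :=
  ereal_sup [set ereal_inf [set (F u w)%:E | w in Sw] | u in Su].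

Definition min_max F : \bar R :=
  ereal_inf [set ereal_sup [set (F u w)%:E | w in Sw] | u in Su].

Definition min_max_swap F : \bar R :=
  ereal_inf [set ereal_sup [set (F u w)%:E | u in Su] | w in Sw].

End MaxMin.

(* VA and VB are the optimal values for A and B. Whenever r is finite in the
   intended use, they are either finite everywhere or (if Su or Sw is empty)
   one and the same infinite constant, so that fine loses nothing. *)
Definition expectation_bound (d : measure_display) (T : measurableType d)
    (R : realType) (P : probability T R) (C0 : R) (r : \bar R)
    (VA VB : T -> \bar R) : Prop :=
  forall g : R -> R, C3 g ->
    (`| 'E_P[(fun t => g (fine (VA t)))] - 'E_P[(fun t => g (fine (VB t)))] |
      <= C0%:E * Kg g * r)%E.

Definition tail_bound (d : measure_display) (T : measurableType d)
    (R : realType) (P : probability T R) (C1 : R) (r : \bar R)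
    (VA VB : T -> \bar R) : Prop :=
  forall z eps : R, 0 < eps ->
    (P [set t | (z + 3 * eps)%:E < VA t]
      <= P [set t | (z + eps)%:E < VB t]
         + (C1 * Num.max 1 (eps ^- 3))%:E * r)%E.

(* Main.v *)
Require Import Defs.
From HB Require Import structures.
From mathcomp Require Import all_boot all_order all_algebra.
From mathcomp Require Import all_classical all_reals all_analysis measurable_realfun.
From mathcomp Require Import ring lra.

Set Implicit Arguments.
Unset Strict Implicit.
Unset Printing Implicit Defensive.

Import Order.TTheory GRing.Theory Num.Theory.
Import numFieldNormedType.Exports.

Local Open Scope classical_set_scope.
Local Open Scope ring_scope.

(* Replace S_u and S_w by finite nets of mesh delta, and the max-min over the
   nets by a soft max-min at inverse temperature b.  Both errors are explicit:
   the modulus of Q plus a term linear in the entries of A for the nets, and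
   (log of the number of net points) / b for the soft max-min.  The soft
   max-min is built from exponentials of affine functions of the entries of A
   by sums, inverses and a logarithm, so its k-th derivative in one entry is at
   most a constant times a^k b^(k-1), where a = L^2 / m^(3/2).  Exchanging the
   entries of A for those of B one at a time (Lindeberg), the moments up to
   order two cancel and each exchange costs K_g a^3 b^2 M_0.  Balancing this
   against the soft max-min error gives b = n^(7/6) log^(1/3)(L/delta) / L^2;
   when this is below 1 the claim is trivial, as r_n is then bounded below.
   The tail bound follows by applying the estimate to a smooth step. *)

(** * Derivatives of soft extrema *)

Section Calculus.
Context (R : realType).
Implicit Types (f g h : R -> R) (a b c l x : R).

(** The nets have exponentially many points in [m + n], so their size may enter only through the
    logarithm in the soft max-min error, never through a derivative bound. This is why derivatives
    are measured relative to the function: a bound [c * l ^+ k * h] on the k-th derivative of [h]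
    passes to sums of any length with the same [c], and to inverses with a new [c] depending on the
    old one alone. The minimum inside the maximum costs one inverse. Up to constants, [m n]
    exchanges at cost [a^3 b^2] add up to [n^(-5/2) L^6 b^2], to be weighed against
    [n log(L/delta) / b]; equality gives the stated [b] and the exponent 1/6 of [n]. The condition
    [1 <= b] lets [a^3 b^2] dominate every term of the chain rule for [g] composed with the soft
    value. Two further obstacles: [A] and [B] live on one space with no assumption on their joint
    law, and optimal values over uncountable sets are not measurable by construction. A product
    space settles the former, Lipschitz continuity in the entries the latter. *)

Definition has_deriv f f' := forall x, is_derive x 1 f (f' x).

Lemma has_deriv_eq f f' f'' : (forall x, f' x = f'' x) ->
  has_deriv f f' -> has_deriv f f''.
Proof. by move=> e df x; rewrite -e. Qed.

Lemma has_deriv_affine a b : has_deriv (fun x => a + b * x) (fun=> b).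
Proof.
move=> x.
have -> : (fun x => a + b * x) = cst a + b \*: (id : R -> R) by [].
by apply: is_derive_eq; rewrite add0r scaler1.
Qed.

Lemma has_derivD f f' g g' : has_deriv f f' -> has_deriv g g' ->
  has_deriv (fun x => f x + g x) (fun x => f' x + g' x).
Proof. by move=> df dg x; exact: is_deriveD. Qed.

Lemma has_derivN f f' : has_deriv f f' ->
  has_deriv (fun x => - f x) (fun x => - f' x).
Proof. by move=> df x; exact: is_deriveN. Qed.

Lemma has_derivM f f' g g' : has_deriv f f' -> has_deriv g g' ->
  has_deriv (fun x => f x * g x) (fun x => f' x * g x + f x * g' x).
Proof.
move=> df dg x; have := is_deriveM (df x) (dg x).
by move/is_derive_eq; apply; rewrite addrC /GRing.scale /= mulrC.
Qed.

Lemma has_derivZ c f f' : has_deriv f f' ->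
  has_deriv (fun x => c * f x) (fun x => c * f' x).
Proof. by move=> df x; exact: is_deriveZ. Qed.

Lemma has_deriv_comp f f' g g' : has_deriv f f' -> has_deriv g g' ->
  has_deriv (fun x => f (g x)) (fun x => f' (g x) * g' x).
Proof. by move=> df dg x; exact: is_derive1_comp. Qed.

Lemma has_derivV f f' : (forall x, f x != 0) -> has_deriv f f' ->
  has_deriv (fun x => (f x)^-1) (fun x => - f' x / f x ^+ 2).
Proof.
move=> f0 df x; have := is_deriveV (f0 x) (df x).
by move/is_derive_eq; apply; rewrite /GRing.scale /= mulrC mulrN mulNr.
Qed.

Lemma has_deriv_sum (I : finType) (f f' : I -> R -> R) :
  (forall i, has_deriv (f i) (f' i)) ->
  has_deriv (fun x => \sum_i f i x) (fun x => \sum_i f' i x).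
Proof.
move=> df x.
have -> : (fun x => \sum_i f i x) = \sum_(i < #|I|) f (enum_val i).
  apply/funext => y; rewrite fct_sumE -(big_enum_val (A := I) (fun i => f i y)) /=.
  by apply: eq_bigl.
have -> : \sum_i f' i x = \sum_(i < #|I|) f' (enum_val i) x.
  by rewrite -(big_enum_val (A := I) (fun i => f' i x)) /=; apply: eq_bigl.
by apply: is_derive_sum => i; exact: df.
Qed.

Lemma has_deriv_continuous f f' : has_deriv f f' -> continuous f.
Proof.
move=> df x; apply/differentiable_continuous/derivable1_diffP.
by apply: ex_derive; exact: (df x).
Qed.

Lemma has_derivE f f' x : has_deriv f f' -> derive1 f x = f' x.
Proof. by move=> df; rewrite derive1E; exact: (@derive_val _ _ _ _ _ _ _ (df x)). Qed.

(** The derivative is controlled only on [|y| <= |x|], so that [M] may depend on [x]; this is what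
    allows iteration. *)
Lemma MVT_abs f f' (x : R) (M : R) : has_deriv f f' ->
  (forall y, `|y| <= `|x| -> `|f' y| <= M) -> `|f x - f 0| <= M * `|x|.
Proof.
move=> df bM.
have cf a b : {within `[a, b], continuous f}.
  by apply: continuous_subspaceT; exact: has_deriv_continuous df.
have [x0|x0|->] := ltgtP x 0; last by rewrite subrr normr0 mulr0.
- have [y] := MVT x0 (fun z _ => df z) (cf _ _).
  rewrite in_itv /= => /andP[xy y0] e.
  rewrite distrC e normrM sub0r normrN ler_wpM2r// bM//.
  by rewrite !ltr0_norm// lerN2 ltW.
- have [y] := MVT x0 (fun z _ => df z) (cf _ _).
  rewrite in_itv /= => /andP[y0 yx] e.
  by rewrite e normrM subr0 ler_wpM2r// bM// !gtr0_norm// ltW.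
Qed.

(* Iterating the mean value theorem loses the factor 1/3! but needs no
   further integration. *)
Lemma taylor2_bound f f1 f2 f3 (M : R) :
  has_deriv f f1 -> has_deriv f1 f2 -> has_deriv f2 f3 ->
  (forall x, `|f3 x| <= M) ->
  forall x, `|f x - (f 0 + f1 0 * x + f2 0 / 2 * x ^+ 2)| <= M * `|x| ^+ 3.
Proof.
move=> d1 d2 d3 bM x.
have M0 : 0 <= M by exact: le_trans (normr_ge0 _) (bM 0).
have B2 z : `|f2 z - f2 0| <= M * `|z| by apply: MVT_abs d3 _ => y _.
have B1 z : `|f1 z - f1 0 - f2 0 * z| <= M * `|z| ^+ 2.
  have dh : has_deriv (fun z => f1 z + (- f1 0 + (- f2 0) * z))
                      (fun z => f2 z + (- f2 0)).
    by apply: has_derivD => //; exact: has_deriv_affine.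
  have := @MVT_abs _ _ z (M * `|z|) dh; rewrite -mulrA -expr2.
  have -> : f1 z + (- f1 0 + - f2 0 * z) - (f1 0 + (- f1 0 + - f2 0 * 0)) =
    f1 z - f1 0 - f2 0 * z by ring.
  apply => y yz; apply: le_trans (B2 y) _; exact: ler_wpM2l.
have dh : has_deriv
    (fun z => f z + ((- f 0 + (- f1 0) * z) + (- f2 0 / 2) * (z * z)))
    (fun z => f1 z + (- f1 0 + (- f2 0 / 2) * (1 * z + z * 1))).
  apply: has_derivD => //; apply: has_derivD; first exact: has_deriv_affine.
  apply: has_derivZ; apply: has_derivM; move=> y; exact: is_derive_id.
have := @MVT_abs _ _ x (M * `|x| ^+ 2) dh.
rewrite (_ : M * `|x| ^+ 2 * `|x| = M * `|x| ^+ 3); last by ring.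
have -> : f x + (- f 0 + - f1 0 * x + - f2 0 / 2 * (x * x)) -
  (f 0 + (- f 0 + - f1 0 * 0 + - f2 0 / 2 * (0 * 0))) =
  f x - (f 0 + f1 0 * x + f2 0 / 2 * x ^+ 2) by ring.
apply => y yx.
have -> : f1 y + (- f1 0 + - f2 0 / 2 * (1 * y + y * 1)) =
  f1 y - f1 0 - f2 0 * y by field.
by apply: le_trans (B1 y) _; rewrite ler_wpM2l// lerXn2r// nnegrE.
Qed.

(* The bounds are relative to [h] because such bounds survive sums and
   inverses. *)
Record log_jet c l (h h1 h2 h3 : R -> R) : Prop := LogJet {
  log_jet_gt0 : forall x, 0 < h x ;
  log_jetD1 : has_deriv h h1 ;
  log_jetD2 : has_deriv h1 h2 ;
  log_jetD3 : has_deriv h2 h3 ;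
  log_jet1 : forall x, `|h1 x| <= c * l * h x ;
  log_jet2 : forall x, `|h2 x| <= c * l ^+ 2 * h x ;
  log_jet3 : forall x, `|h3 x| <= c * l ^+ 3 * h x }.

(** Any [l] above [|q|] is allowed, so that exponentials with different slopes share one [l]. *)
Lemma log_jet_exp p q l : `|q| <= l -> log_jet 1 l (fun x => expR (p + q * x))
  (fun x => q * expR (p + q * x)) (fun x => q ^+ 2 * expR (p + q * x))
  (fun x => q ^+ 3 * expR (p + q * x)).
Proof.
move=> ql.
have d : has_deriv (fun x => expR (p + q * x)) (fun x => q * expR (p + q * x)).
  apply: has_deriv_eq (has_deriv_comp (@is_derive_expR R) (has_deriv_affine p q)).
  by move=> x; rewrite mulrC.
have B (k : nat) x : `|q ^+ k * expR (p + q * x)| <= 1 * l ^+ k * expR (p + q * x).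
  rewrite normrM mul1r (ger0_norm (expR_ge0 _)) ler_wpM2r ?expR_ge0//.
  by rewrite normrX lerXn2r// nnegrE// (le_trans _ ql).
split=> [x|//|||x|x|x]; rewrite ?expR_gt0 ?(B 2%N) ?(B 3%N) ?(B 1%N)//.
- apply: has_deriv_eq (has_derivZ q d) => x; ring.
- apply: has_deriv_eq (has_derivZ (q ^+ 2) d) => x; ring.
Qed.

(** The bounds are linear in [h], so neither [c] nor [l] grows with the number of summands; [i0]
    makes the sum positive. *)
Lemma log_jet_sum (I : finType) c l (h h1 h2 h3 : I -> R -> R) (i0 : I) :
  (forall i, log_jet c l (h i) (h1 i) (h2 i) (h3 i)) ->
  log_jet c l (fun x => \sum_i h i x) (fun x => \sum_i h1 i x)
    (fun x => \sum_i h2 i x) (fun x => \sum_i h3 i x).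
Proof.
move=> H.
have B (k : I -> R -> R) C x : (forall i, `|k i x| <= C * h i x) ->
    `|\sum_i k i x| <= C * \sum_i h i x.
  move=> kC; rewrite mulr_sumr; apply: le_trans (ler_norm_sum _ _ _) _.
  exact: ler_sum.
split=> [x||||x|x|x].
- rewrite (bigD1 i0)//= ltr_pwDl ?(log_jet_gt0 (H i0))//.
  by apply: sumr_ge0 => i _; exact/ltW/(log_jet_gt0 (H i)).
- apply: has_deriv_sum => i; exact: log_jetD1 (H i).
- apply: has_deriv_sum => i; exact: log_jetD2 (H i).
- apply: has_deriv_sum => i; exact: log_jetD3 (H i).
- apply: B => i; exact: (log_jet1 (H i)).
- apply: B => i; exact: (log_jet2 (H i)).
- apply: B => i; exact: (log_jet3 (H i)).
Qed.

Lemma log_jet_ratio c l h h1 h2 h3 : log_jet c l h h1 h2 h3 -> forall x,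
  [/\ `|h1 x / h x| <= c * l, `|h2 x / h x| <= c * l ^+ 2
    & `|h3 x / h x| <= c * l ^+ 3].
Proof.
move=> H x; have hx := log_jet_gt0 H x.
by split; rewrite normrM normfV (gtr0_norm hx) ler_pdivrMr//;
  [exact: log_jet1 H _|exact: log_jet2 H _|exact: log_jet3 H _].
Qed.

(** With [a] and [b] the ratios of h' and h'' to h, these are the monomials in the derivatives of
    1/h and ln h; [1 <= c] lets them share the constant [c ^+ 3]. *)
Lemma jet_bounds c l a b : 1 <= c -> 0 <= l ->
  `|a| <= c * l -> `|b| <= c * l ^+ 2 ->
  [/\ `|a * a| <= c ^+ 3 * l ^+ 2, `|a * b| <= c ^+ 3 * l ^+ 3
    & `|a * a * a| <= c ^+ 3 * l ^+ 3].
Proof.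
move=> c1 l0 ha hb; have c0 : 0 <= c by exact: le_trans c1.
have cc : c ^+ 2 <= c ^+ 3 by rewrite (exprS c 2) ler_peMl// exprn_ge0.
split; rewrite !normrM.
- apply: (@le_trans _ _ (c * l * (c * l))); first exact: ler_pM.
  rewrite (_ : c * l * (c * l) = c ^+ 2 * l ^+ 2); last by ring.
  by rewrite ler_wpM2r// exprn_ge0.
- apply: (@le_trans _ _ (c * l * (c * l ^+ 2))); first exact: ler_pM.
  rewrite (_ : c * l * (c * l ^+ 2) = c ^+ 2 * l ^+ 3); last by ring.
  by rewrite ler_wpM2r// exprn_ge0.
- apply: (@le_trans _ _ (c * l * (c * l) * (c * l))).
    by apply: ler_pM => //; exact: ler_pM.
  by rewrite (_ : _ * (c * l) = c ^+ 3 * l ^+ 3)//; ring.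
Qed.

Lemma le_cube c : 1 <= c -> c <= c ^+ 3.
Proof. by move=> c1; rewrite exprS ler_peMr ?exprn_ege1// (le_trans _ c1). Qed.

(** The ratios satisfy r1' = r2 - r1^2 and r2' = r3 - r1 r2, so every derivative of 1/h is a
    polynomial in them times 1/h. The third has coefficients 1, 6, 6, whence 13. *)
Lemma log_jetV c l h h1 h2 h3 : 1 <= c -> 0 <= l ->
  log_jet c l h h1 h2 h3 ->
  exists k1 k2 k3, log_jet (13 * c ^+ 3) l (fun x => (h x)^-1) k1 k2 k3.
Proof.
move=> c1 l0 H; have h0 x := log_jet_gt0 H x.
have hn x : h x != 0 by rewrite gt_eqF.
have D0 := has_derivV hn (log_jetD1 H).
pose k x := (h x)^-1.
pose r1 x := h1 x / h x; pose r2 x := h2 x / h x; pose r3 x := h3 x / h x.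
have [[d1 d2] d3] := (log_jetD1 H, log_jetD2 H, log_jetD3 H).
have dr1 : has_deriv r1 (fun x => r2 x - r1 x * r1 x).
  by apply: has_deriv_eq (has_derivM d2 D0) => x; rewrite /r1 /r2; field.
have dr2 : has_deriv r2 (fun x => r3 x - r1 x * r2 x).
  by apply: has_deriv_eq (has_derivM d3 D0) => x; rewrite /r1 /r2 /r3; field.
have dk : has_deriv k (fun x => - (r1 x * k x)).
  by apply: has_deriv_eq D0 => x; rewrite /r1 /k; field.
exists (fun x => - (r1 x * k x)).
exists (fun x => (2 * (r1 x * r1 x) - r2 x) * k x).
exists (fun x => (- (r3 x) + 6 * (r1 x * r2 x) - 6 * (r1 x * r1 x * r1 x)) * k x).
have c0 : 0 <= c by exact: le_trans c1.
have c3 := le_cube c1.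
have kx x : 0 < k x by rewrite /k invr_gt0.
have B (r : R -> R) C x : `|r x| <= C -> `|r x * k x| <= C * (h x)^-1.
  by move=> ?; rewrite normrM (gtr0_norm (kx x)) ler_wpM2r// ltW// kx.
split=> [x||||x|x|x]; rewrite ?invr_gt0 ?h0//.
- apply: has_deriv_eq (has_derivN (has_derivM dr1 dk)) => x; ring.
- apply: has_deriv_eq (has_derivM (has_derivD (has_derivZ 2 (has_derivM dr1
      dr1)) (has_derivN dr2)) dk) => x; ring.
- have [e1 e2 e3] := log_jet_ratio H x.
  rewrite normrN; apply: B; apply: le_trans e1 _; apply: ler_wpM2r => //; lra.
- have [e1 e2 e3] := log_jet_ratio H x.
  apply: (B (fun x => 2 * (r1 x * r1 x) - r2 x)).
  have [f1 f2 f3] := jet_bounds c1 l0 e1 e2.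
  have := ler_normB (2 * (r1 x * r1 x)) (r2 x).
  rewrite (normrM 2) (@ger0_norm _ 2)// => h'.
  have l2 : 0 <= l ^+ 2 by rewrite exprn_ge0.
  have := ler_wpM2r l2 c3; rewrite -/(r1 x) -/(r2 x) in e1 e2 f1 *.
  have : 0 <= c ^+ 3 * l ^+ 2 by rewrite mulr_ge0// exprn_ge0.
  rewrite -(mulrA 13); lra.
- have [e1 e2 e3] := log_jet_ratio H x.
  apply: (B (fun x => - r3 x + 6 * (r1 x * r2 x) - 6 * (r1 x * r1 x * r1 x))).
  have [f1 f2 f3] := jet_bounds c1 l0 e1 e2.
  have := ler_normB (- r3 x + 6 * (r1 x * r2 x)) (6 * (r1 x * r1 x * r1 x)).
  have := ler_normD (- r3 x) (6 * (r1 x * r2 x)).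
  rewrite (normrM 6) (normrM 6) (@ger0_norm _ 6)// normrN => h' h''.
  have l3 : 0 <= l ^+ 3 by rewrite exprn_ge0.
  have := ler_wpM2r l3 c3; rewrite -/(r1 x) -/(r2 x) -/(r3 x) in e1 e2 e3 f1 f2 f3 *.
  rewrite -(mulrA 13); lra.
Qed.

Record smooth_jet a b (f f1 f2 f3 : R -> R) : Prop := SmoothJet {
  smooth_jetD1 : has_deriv f f1 ;
  smooth_jetD2 : has_deriv f1 f2 ;
  smooth_jetD3 : has_deriv f2 f3 ;
  smooth_jet1 : forall x, `|f1 x| <= a ;
  smooth_jet2 : forall x, `|f2 x| <= a ^+ 2 * b ;
  smooth_jet3 : forall x, `|f3 x| <= a ^+ 3 * b ^+ 2 }.

Lemma has_deriv_ln h h1 : (forall x, 0 < h x) -> has_deriv h h1 ->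
  has_deriv (fun x => ln (h x)) (fun x => h1 x / h x).
Proof.
move=> h0 dh x; have := is_derive1_comp (is_derive1_ln (h0 x)) (dh x).
by rewrite mulrC.
Qed.

(** The third derivative of ln h is r3 - 3 r1 r2 + 2 r1^3, whence 6 = 1 + 3 + 2. The factor
    [6 * c ^+ 3] is at least 1, hence below its powers, and can be absorbed into the scale [a]. *)
Lemma smooth_jet_ln c a b h h1 h2 h3 : 1 <= c -> 0 <= a -> 0 < b ->
  log_jet c (b * a) h h1 h2 h3 ->
  exists f1 f2 f3, smooth_jet (6 * c ^+ 3 * a) b (fun x => b^-1 * ln (h x)) f1 f2 f3.
Proof.
move=> c1 a0 b0 H; have h0 x := log_jet_gt0 H x.
have hn x : h x != 0 by rewrite gt_eqF.
have bn : b != 0 by rewrite gt_eqF.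
have D0 := has_derivV hn (log_jetD1 H).
pose r1 x := h1 x / h x; pose r2 x := h2 x / h x; pose r3 x := h3 x / h x.
have [[d1 d2] d3] := (log_jetD1 H, log_jetD2 H, log_jetD3 H).
have dr1 : has_deriv r1 (fun x => r2 x - r1 x * r1 x).
  by apply: has_deriv_eq (has_derivM d2 D0) => x; rewrite /r1 /r2; field.
have dr2 : has_deriv r2 (fun x => r3 x - r1 x * r2 x).
  by apply: has_deriv_eq (has_derivM d3 D0) => x; rewrite /r1 /r2 /r3; field.
exists (fun x => b^-1 * r1 x), (fun x => b^-1 * (r2 x - r1 x * r1 x)).
exists (fun x => b^-1 * (r3 x - 3 * (r1 x * r2 x) + 2 * (r1 x * r1 x * r1 x))).
have c3 := le_cube c1.
have c31 : 1 <= c ^+ 3 by rewrite exprn_ege1.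
have l0 : 0 <= b * a by rewrite mulr_ge0// ltW.
have B (r y : R) : `|r| <= b * y -> `|b^-1 * r| <= y.
  by move=> e; rewrite normrM normfV (gtr0_norm b0) mulrC ler_pdivrMr// mulrC.
have K2 : 6 * c ^+ 3 <= (6 * c ^+ 3) ^+ 2 by rewrite expr2 ler_peMr; lra.
have K3 : 6 * c ^+ 3 <= (6 * c ^+ 3) ^+ 3 by apply: le_cube; lra.
split=> [|||x|x|x].
- exact: has_derivZ (has_deriv_ln h0 d1).
- by apply: has_derivZ; apply: has_deriv_eq dr1.
- apply: has_derivZ.
  apply: has_deriv_eq (has_derivD dr2 (has_derivN (has_derivM dr1 dr1))) => x.
  ring.
- have [e1 e2 e3] := log_jet_ratio H x.
  apply: B; apply: le_trans e1 _.
  by rewrite [leRHS](_ : _ = 6 * c ^+ 3 * (b * a)); [rewrite ler_wpM2r//; lra|ring].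
- have [e1 e2 e3] := log_jet_ratio H x.
  have [f1 f2 f3] := jet_bounds c1 l0 e1 e2.
  apply: B; rewrite [leRHS](_ : _ = (6 * c ^+ 3) ^+ 2 * (b * a) ^+ 2); last by ring.
  have l2 : 0 <= (b * a) ^+ 2 by rewrite exprn_ge0.
  have := ler_normB (r2 x) (r1 x * r1 x).
  have := ler_wpM2r l2 c3; have := ler_wpM2r l2 K2.
  have : 0 <= c ^+ 3 * (b * a) ^+ 2 by rewrite mulr_ge0//; lra.
  rewrite -/(r1 x) -/(r2 x) in e1 e2 f1 *; rewrite -(mulrA 6 (c ^+ 3)); lra.
- have [e1 e2 e3] := log_jet_ratio H x.
  have [f1 f2 f3] := jet_bounds c1 l0 e1 e2.
  apply: B; rewrite [leRHS](_ : _ = (6 * c ^+ 3) ^+ 3 * (b * a) ^+ 3); last by ring.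
  have l3 : 0 <= (b * a) ^+ 3 by rewrite exprn_ge0.
  have := ler_normD (r3 x - 3 * (r1 x * r2 x)) (2 * (r1 x * r1 x * r1 x)).
  have := ler_normB (r3 x) (3 * (r1 x * r2 x)).
  rewrite (normrM 3) (normrM 2) (@ger0_norm _ 3)// (@ger0_norm _ 2)//.
  have := ler_wpM2r l3 c3; have := ler_wpM2r l3 K3.
  have : 0 <= c ^+ 3 * (b * a) ^+ 3 by rewrite mulr_ge0//; lra.
  rewrite -/(r1 x) -/(r2 x) -/(r3 x) in e1 e2 e3 f1 f2 f3 *.
  rewrite -(mulrA 6 (c ^+ 3)); lra.
Qed.

Lemma smooth_jetN a b f f1 f2 f3 : smooth_jet a b f f1 f2 f3 ->
  smooth_jet a b (fun x => - f x) (fun x => - f1 x) (fun x => - f2 x)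
    (fun x => - f3 x).
Proof.
case=> d1 d2 d3 b1 b2 b3.
by split=> [|||x|x|x]; rewrite ?normrN//; exact: has_derivN.
Qed.

(** The terms g'' f'^2 and g''' f'^3 carry no power of [b]; [1 <= b] bounds them like the others.
    The factors 2 and 5 are the sums of the chain rule coefficients 1, 1 and 1, 3, 1. *)
Lemma smooth_jet_comp K a b g g1 g2 g3 f f1 f2 f3 : 0 <= a -> 1 <= b ->
  has_deriv g g1 -> has_deriv g1 g2 -> has_deriv g2 g3 ->
  (forall x, [/\ `|g1 x| <= K, `|g2 x| <= K & `|g3 x| <= K]) ->
  smooth_jet a b f f1 f2 f3 ->
  exists k1 k2 k3, [/\ has_deriv (fun x => g (f x)) k1,
     has_deriv k1 k2, has_deriv k2 k3 & forall x,
     [/\ `|k1 x| <= K * a, `|k2 x| <= 2 * K * (a ^+ 2 * b) &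
         `|k3 x| <= 5 * K * (a ^+ 3 * b ^+ 2)]].
Proof.
move=> a0 b1 dg dg1 dg2 bK [d1 d2 d3 e1 e2 e3].
exists (fun x => g1 (f x) * f1 x).
exists (fun x => g2 (f x) * (f1 x * f1 x) + g1 (f x) * f2 x).
exists (fun x => g3 (f x) * (f1 x * f1 x * f1 x) + 3 * (g2 (f x) * (f1 x * f2
    x)) + g1 (f x) * f3 x).
have D1 := has_deriv_comp dg1 d1.
have D2 := has_deriv_comp dg2 d1.
have b0 : 0 <= b by apply: le_trans b1.
split.
- exact: has_deriv_comp.
- apply: has_deriv_eq (has_derivM D1 d2) => x; ring.
- apply: has_deriv_eq (has_derivD (has_derivM D2 (has_derivM d2 d2)) (has_derivM
      D1 d3)) => x; ring.
move=> x; have [k1 k2 k3] := bK (f x).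
have K0 : 0 <= K by apply: le_trans k1.
have a2 : 0 <= a ^+ 2 by rewrite exprn_ge0.
have a3 : 0 <= a ^+ 3 by rewrite exprn_ge0.
have b2 : b <= b ^+ 2 by rewrite expr2 ler_peMr.
have m1 : `|g1 (f x) * f1 x| <= K * a by rewrite normrM ler_pM.
have ff : `|f1 x * f1 x| <= a ^+ 2 * b.
  rewrite normrM; apply: (@le_trans _ _ (a * a)); first exact: ler_pM.
  by rewrite expr2 ler_peMr// mulr_ge0.
have ff2 : `|f1 x * f2 x| <= a ^+ 3 * b ^+ 2.
  rewrite normrM; apply: (@le_trans _ _ (a * (a ^+ 2 * b))).
    by apply: ler_pM => //; rewrite mulr_ge0.
  by rewrite mulrA -exprS ler_wpM2l.
have fff : `|f1 x * f1 x * f1 x| <= a ^+ 3 * b ^+ 2.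
  rewrite normrM; apply: (@le_trans _ _ (a ^+ 2 * b * a)); first exact: ler_pM.
  by rewrite mulrAC -exprSr ler_wpM2l.
split=> //.
- have := ler_normD (g2 (f x) * (f1 x * f1 x)) (g1 (f x) * f2 x).
  have u1 : `|g2 (f x) * (f1 x * f1 x)| <= K * (a ^+ 2 * b).
    by rewrite normrM ler_pM.
  have u2 : `|g1 (f x) * f2 x| <= K * (a ^+ 2 * b).
    by rewrite normrM ler_pM.
  rewrite -(mulrA 2); lra.
- have := ler_normD (g3 (f x) * (f1 x * f1 x * f1 x) + 3 * (g2 (f x) * (f1 x *
      f2 x))) (g1 (f x) * f3 x).
  have := ler_normD (g3 (f x) * (f1 x * f1 x * f1 x)) (3 * (g2 (f x) * (f1 x *
      f2 x))).
  rewrite (normrM 3) (@ger0_norm _ 3)//.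
  have u1 : `|g3 (f x) * (f1 x * f1 x * f1 x)| <= K * (a ^+ 3 * b ^+ 2).
    by rewrite normrM ler_pM.
  have u2 : `|g2 (f x) * (f1 x * f2 x)| <= K * (a ^+ 3 * b ^+ 2).
    by rewrite normrM ler_pM.
  have u3 : `|g1 (f x) * f3 x| <= K * (a ^+ 3 * b ^+ 2).
    by rewrite normrM ler_pM.
  rewrite -(mulrA 5); lra.
Qed.

End Calculus.

(** * Independence *)

Section Independence.
Context (d : measure_display) (T : measurableType d) (R : realType).
Context (P : probability T R).

Lemma integrable_bounded (f : T -> R) (M : R) : measurable_fun setT f ->
  (forall t, `|f t| <= M) -> P.-integrable setT (EFin \o f).
Proof.
move=> mf fM; apply: (le_integrable _ _ _ (finite_measure_integrable_cst P M _))
    => //.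
- exact/measurable_EFinP.
- by move=> t _ /=; rewrite lee_fin; apply: le_trans (fM t) (ler_norm _).
Qed.

(** Factorization on rectangles identifies the joint law with the product of the marginal laws, by
    uniqueness of the product measure; Fubini then splits the integral. *)
Lemma Rintegral_indepM (H Y : T -> R) (M : R) :
  measurable_fun setT H -> measurable_fun setT Y ->
  (forall t, `|H t| <= M) -> P.-integrable setT (EFin \o Y) ->
  (forall A B, measurable A -> measurable B ->
    P (H @^-1` A `&` Y @^-1` B) = (P (H @^-1` A) * P (Y @^-1` B))%E) ->
  \int[P]_t (H t * Y t) = (\int[P]_t H t) * (\int[P]_t Y t).
Proof.
move=> mH mY HM iY ind.
pose H' : {mfun T >-> R} := HB.pack H (isMeasurableFun.Build _ _ _ _ H mH).
pose Y' : {mfun T >-> R} := HB.pack Y (isMeasurableFun.Build _ _ _ _ Y mY).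
have mHY : measurable_fun setT (fun t => (H t, Y t)) by exact: measurable_fun_pair.
pose HY : {mfun T >-> (R * R)%type} :=
  HB.pack (fun t => (H t, Y t)) (isMeasurableFun.Build _ _ _ _ _ mHY).
pose f (x : R * R) : \bar R := (x.1 * x.2)%:E.
have mf : measurable_fun [set: R * R] f.
  apply/measurable_EFinP; apply: measurable_funM.
  - exact: measurable_fst.
  - exact: measurable_snd.
have iH : P.-integrable setT (EFin \o H) by exact: integrable_bounded HM.
have iHY : P.-integrable setT (f \o HY).
  have : P.-integrable setT (fun t => M%:E * (EFin \o Y) t)%E by exact: integrableZl.
  apply: le_integrable => //.
    exact: measurableT_comp.
  move=> t _ /=; rewrite lee_fin !normrM ler_wpM2r//.
  exact: le_trans (HM t) (ler_norm _).
have e : forall C, measurable C ->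
    (distribution P H' \x distribution P Y')%E C = distribution P HY C.
  apply: product_measure_unique => A B mA mB; rewrite /distribution /pushforward /=.
  by rewrite -ind//; congr (P _); apply/seteqP; split=> t.
have mid : measurable_fun [set: R] (EFin : _ -> \bar R).
  exact/measurable_EFinP.
have iYd : (distribution P Y').-integrable setT EFin.
  exact: integrable_pushforward.
have iHd : (distribution P H').-integrable setT EFin.
  exact: integrable_pushforward.
have if2 : (distribution P H' \x distribution P Y')%E.-integrable setT f.
  have : (distribution P HY).-integrable setT f by exact: integrable_pushforward.
  move=> /integrableP[_ hf]; apply/integrableP; split=> //.
  by rewrite (eq_measure_integral (distribution P HY))// => C mC _;
      first [exact: e | exact/esym/e].
rewrite /Rintegral -fineM; try exact: integrable_fin_num.
congr fine.
transitivity (\int[distribution P HY]_x f x)%E.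
  by rewrite integral_distribution.
transitivity (\int[(distribution P H' \x distribution P Y')]_x f x)%E.
  by apply: eq_measure_integral => C mC _; first [exact: e | exact/esym/e].
rewrite -integral12_prod_meas1// /fubini_F /f /=.
under eq_integral.
  move=> x _; under eq_integral do rewrite EFinM.
  rewrite integralZl//; over.
have fY : (\int[distribution P Y']_y y%:E)%E \is a fin_num.
  exact: integrable_fin_num.
rewrite -(fineK fY) integralZr//; congr (_ * _)%E.
- by rewrite integral_distribution.
- by rewrite fineK// integral_distribution.
Qed.

Context (I : finType) (X : I -> T -> R).
Hypothesis mX : forall i, measurable_fun setT (X i).

(** [independent_RVs] for unbundled functions, so that it also applies to families built by hand,
    such as the one on [T * T] below. *)
Definition independent_funs := forall (J : {set I}) (E : I -> set R),
  (forall i, measurable (E i)) ->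
  P (\bigcap_(i in [set` J]) (X i @^-1` E i)) =
  (\big[*%E/1]_(i in J) P (X i @^-1` E i))%E.

(* A pi-system generating the sigma-algebra of the variables other than [k]. *)
Definition rectangles_off (k : I) : set (set T) :=
  [set C | exists2 E : I -> set R, (forall i, measurable (E i)) &
    C = \bigcap_(i in [set i | i != k]) (X i @^-1` E i)].

Lemma rectangles_off_measurable k : rectangles_off k `<=` measurable.
Proof.
move=> _ [E mE ->]; apply: fin_bigcap_measurable; first exact: finite_finset.
by move=> i _; rewrite -[_ @^-1` _]setTI; exact: mX.
Qed.

Lemma measurable_off k i : i != k ->
  measurable_fun [set: g_sigma_algebraType (rectangles_off k)] (X i).
Proof.
move=> ik _ B mB; rewrite setTI; apply: sub_sigma_algebra.
exists (fun j => if j == i then B else setT); first by move=> j; case: ifP.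
apply/seteqP; split=> t.
- by move=> Xt j jk /=; case: eqP => [->|].
- by move=> /(_ i ik) /=; rewrite eqxx.
Qed.

(** For fixed [B] both sides are finite measures in [C]. They agree on the pi-system of rectangles,
    hence on the sigma-algebra that it generates. *)
Lemma independent_off k (C : set T) (B : set R) : independent_funs ->
  (<<s rectangles_off k >>) C -> measurable B ->
  P (C `&` X k @^-1` B) = (P C * P (X k @^-1` B))%E.
Proof.
move=> ind hC mB.
have mXB : measurable (X k @^-1` B) by rewrite -[_ @^-1` _]setTI; exact: mX.
pose m1 : {measure set T -> \bar R} := mrestr P mXB.
pose r : {nonneg R} := NngNum (fine_ge0 (measure_ge0 P (X k @^-1` B))).
pose m2 : {measure set T -> \bar R} := mscale r P.
suff : m1 C = m2 C.
  rewrite /m1 /m2 /= /mrestr /mscale /= => ->; rewrite muleC fineK//.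
  exact: fin_num_measure.
apply: (g_sigma_algebra_measure_unique (rectangles_off k)
    (@rectangles_off_measurable k)
  (fun=> setT)) => //.
- move=> _; exists (fun=> setT) => //; apply/seteqP; split=> // t _ i _ //.
- by apply/seteqP; split=> // t _; exists 0%N.
- move=> _ _ [E mE ->] [F mF ->]; exists (fun i => E i `&` F i).
    by move=> i; exact: measurableI.
  apply/seteqP; split=> t.
    by move=> [h1 h2] i ik; split; [exact: h1|exact: h2].
  by move=> h; split=> i ik; have [] := h i ik.
- move=> _ [E mE ->]; rewrite /m1 /m2 /= /mrestr /mscale /= fineK ?fin_num_measure//.
  (* Independence over all indices gives the rectangle intersected with the event for [X k]; over
     the indices other than [k] it gives the rectangle alone. The two products differ by the factor
     of [k]. *)
  pose E' i := if i == k then B else E i.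
  have mE' i : measurable (E' i) by rewrite /E'; case: ifP.
  have := ind [set: I]%SET E' mE'; rewrite big_mkcond (bigD1 k)//= !inE {2}/E'
      eqxx => h1.
  have := ind [set~ k]%SET E' mE'; rewrite big_mkcond (bigD1 k)//= !inE eqxx/=
      mul1e => h2.
  have -> : \bigcap_(i in [set i | i != k]) X i @^-1` E i =
            \bigcap_(i in [set` [set~ k]%SET]) X i @^-1` E' i.
    apply/seteqP; split=> t h i /=.
    - by rewrite !inE => ik; rewrite /E' (negbTE ik); exact: h.
    - by move=> ik; have := h i; rewrite /= !inE /E' (negbTE ik); exact.
  rewrite h2 -[X in P X](_ : \bigcap_(i in [set` [set: I]%SET]) X i @^-1` E' i = _).
    rewrite h1; congr (_ * _)%E; apply: eq_bigr => i ik.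
    by rewrite !inE ik.
  apply/seteqP; split=> t.
  - move=> h; split.
      by move=> i _; apply: h; rewrite /= inE.
    by have := h k; rewrite /= inE /E' eqxx; exact.
  - move=> [h hk] i _; have [->|ik] := eqVneq i k; first by rewrite /E' eqxx.
    by apply: h; rewrite /= !inE.
- move=> n; rewrite /m1 /= /mrestr ltey_eq fin_num_measure//.
  exact: measurableI.
Qed.

Lemma measurable_off_weaken k (H : T -> R) :
  measurable_fun [set: g_sigma_algebraType (rectangles_off k)] H ->
  measurable_fun [set: T] H.
Proof.
move=> mH _ B mB; have := mH measurableT _ mB; rewrite !setTI.
apply: smallest_sub; first exact: sigma_algebra_measurable.
exact: rectangles_off_measurable.
Qed.

Lemma Rintegral_indep_off k (H : T -> R) (M : R) (f : R -> R) :
  independent_funs ->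
  measurable_fun [set: g_sigma_algebraType (rectangles_off k)] H ->
  (forall t, `|H t| <= M) -> measurable_fun setT f ->
  P.-integrable setT (EFin \o (f \o X k)) ->
  \int[P]_t (H t * f (X k t)) = (\int[P]_t H t) * (\int[P]_t f (X k t)).
Proof.
move=> ind mH HM mf ifX.
apply: (@Rintegral_indepM _ (f \o X k) M) => //.
- exact: measurable_off_weaken mH.
- exact: measurableT_comp.
- move=> A B mA mB; rewrite comp_preimage; apply: independent_off => //.
  + by have := mH measurableT _ mA; rewrite setTI.
  + by rewrite -[_ @^-1` _]setTI; exact: mf.
Qed.

End Independence.

(** * Lindeberg exchange *)

Section Lindeberg.
Context (R : realType) (I : finType).
Implicit Types (x : I -> R) (F : (I -> R) -> R).

Definition update x k (s : R) : I -> R := fun i => if i == k then s else x i.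

(** All measurable spaces are quantified over because [F] is evaluated on [T], on [T * T], and on
    [T] with the smaller sigma-algebra of the variables other than one. *)
Definition coordinatewise_measurable F :=
  forall (d : measure_display) (T : measurableType d) (X : I -> T -> R),
    (forall i, measurable_fun setT (X i)) ->
    measurable_fun setT (fun t => F (fun i => X i t)).

(** [B] only makes the Taylor coefficients integrable; the exchange error involves [M] alone. *)
Definition smooth_coordinates F (B M : R) := forall x k, exists f1 f2 f3,
  [/\ has_deriv (fun s => F (update x k s)) f1, has_deriv f1 f2,
      has_deriv f2 f3 &
      forall s, [/\ `|f1 s| <= B, `|f2 s| <= B & `|f3 s| <= M]].

Lemma measurable_update (d : measure_display) (T : measurableType d)
    (X : I -> T -> R) k (Y : T -> R) :
  (forall i, i != k -> measurable_fun setT (X i)) -> measurable_fun setT Y ->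
  forall i, measurable_fun setT (fun t => update (X ^~ t) k (Y t) i).
Proof.
move=> mX mY i; rewrite /update; have [_//|ik] := eqVneq i k.
exact: mX.
Qed.

(** Difference quotients with steps 1/(n+1) are measurable and converge pointwise to the derivative.
    Applied with the sigma-algebra of the other variables, this makes the Taylor coefficients
    independent of the exchanged one. *)
Lemma measurable_derivative (d : measure_display) (T : measurableType d)
    (f f' : T -> R -> R) :
  (forall s, measurable_fun setT (f ^~ s)) ->
  (forall t, has_deriv (f t) (f' t)) ->
  forall s, measurable_fun setT (f' ^~ s).
Proof.
move=> mf df s.
pose h (n : nat) t := n.+1%:R * (f t (n.+1%:R^-1 + s) - f t s).
apply: (@measurable_fun_cvg _ _ _ _ h).
  move=> n; apply: measurable_funM => //; exact: measurable_funB.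
move=> t _.
have [dv <-] := df t s.
have /cvgr_dnbhsP/(_ (fun n => n.+1%:R^-1)) :
  (fun z => z^-1 *: ((f t \o shift s) (z *: (1:R)) - f t s)) @ 0^' --> 'D_1 (f t) s.
  exact: dv.
have n0 n : (n.+1%:R^-1 : R) != 0 by rewrite invr_eq0.
move=> /(_ (conj n0 cvg_harmonic)); apply: cvg_trans.
apply: near_eq_cvg; apply: nearW => n /=.
by rewrite /h invrK /GRing.scale /= mulr1.
Qed.

Context (d : measure_display) (T : measurableType d) (P : probability T R).

Lemma integrable_powers (V : T -> R) : measurable_fun setT V ->
  P.-integrable setT (EFin \o (fun t => `|V t| ^+ 3)) ->
  P.-integrable setT (EFin \o V) /\
  P.-integrable setT (EFin \o (fun t => V t ^+ 2)).
Proof.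
move=> mV iV.
have i1 : P.-integrable setT (fun t => (1 + `|V t| ^+ 3)%:E).
  have := integrableD measurableT (finite_measure_integrable_cst P 1 measurableT) iV.
  by apply: eq_integrable.
have le1 (y : R) : 0 <= y -> y <= 1 + y ^+ 3 /\ y ^+ 2 <= 1 + y ^+ 3.
  move=> y0; have [y1|/ltW y1] := leP y 1.
    have := exprn_ge0 3 y0; have : y ^+ 2 <= 1 by rewrite exprn_ile1.
    by split; lra.
  have : y <= y ^+ 3 by rewrite exprS ler_peMr// exprn_ege1.
  have : y ^+ 2 <= y ^+ 3 by rewrite [leRHS]exprS ler_peMl// exprn_ge0.
  by split; lra.
split; apply: le_integrable i1 => //.
- exact/measurable_EFinP.
- move=> t _ /=; rewrite lee_fin.
  by apply: le_trans (ler_norm _); have [] := le1 _ (normr_ge0 (V t)).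
- by apply/measurable_EFinP; exact: measurable_funX.
- move=> t _ /=; rewrite lee_fin normrX.
  by apply: le_trans (ler_norm _); have [] := le1 _ (normr_ge0 (V t)).
Qed.

Context (J : finType) (X : J -> T -> R).
Hypothesis mX : forall j, measurable_fun setT (X j).
Hypothesis indX : independent_funs P X.

(* [W] carries the other coordinates of [F]; the coefficients of the Taylor
   polynomial at [0] do not involve [X k], so its expectation factorizes. *)
Lemma lindeberg_taylor F (K B M : R) (W : I -> T -> R) (i : I) (k : J) :
  coordinatewise_measurable F -> (forall x, `|F x| <= K) ->
  smooth_coordinates F B M ->
  (forall j, j != i ->
    measurable_fun [set: g_sigma_algebraType (rectangles_off X k)] (W j)) ->
  P.-integrable setT (EFin \o (fun t => `|X k t| ^+ 3)) ->
  `| \int[P]_t F (update (W ^~ t) i (X k t)) -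
     (\int[P]_t F (update (W ^~ t) i 0)
      + (\int[P]_t derive1 (fun s => F (update (W ^~ t) i s)) 0) * (\int[P]_t X k t)
      + (\int[P]_t (derive1 (derive1 (fun s => F (update (W ^~ t) i s))) 0 / 2))
         * (\int[P]_t (X k t ^+ 2))) |
  <= M * \int[P]_t (`|X k t| ^+ 3).
Proof.
move=> mF FK sF mW iX3.
have [iX1 iX2] := integrable_powers (mX k) iX3.
pose f t s := F (update (W ^~ t) i s).
pose f1 t := derive1 (f t); pose f2 t := derive1 (f1 t).
have jets t : exists f3, [/\ has_deriv (f t) (f1 t), has_deriv (f1 t) (f2 t),
   has_deriv (f2 t) f3 & forall s, [/\ `|f1 t s| <= B, `|f2 t s| <= B & `|f3 s|
       <= M]].
  have [g1 [g2 [g3 [d1 d2 d3 b]]]] := sF (W ^~ t) i.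
  have e1 : f1 t = g1 by apply/funext => s; exact: has_derivE.
  have e2 : f2 t = g2 by apply/funext => s; rewrite /f2 e1; exact: has_derivE.
  by exists g3; rewrite e1 e2.
have D1 t : has_deriv (f t) (f1 t) by have [? []] := jets t.
have D2 t : has_deriv (f1 t) (f2 t) by have [? []] := jets t.
have B1 t s : `|f1 t s| <= B by have [? [_ _ _ /(_ s)[]]] := jets t.
have B2 t s : `|f2 t s| <= B by have [? [_ _ _ /(_ s)[]]] := jets t.
(* [S] is [T] with the sigma-algebra of the variables other than [X k]; measurability over [S] is
   the form in which independence of [X k] is used. *)
set S := g_sigma_algebraType (rectangles_off X k) in mW.
have mfS s : measurable_fun [set: S] (f ^~ s).
  by apply: (mF _ S (fun j t => update (W ^~ t) i s j)); exact: measurable_update.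
have mf1S s : measurable_fun [set: S] (f1 ^~ s).
  exact: (@measurable_derivative _ S f f1).
have mf2S s : measurable_fun [set: S] (f2 ^~ s).
  exact: (@measurable_derivative _ S f1 f2).
have M0 : 0 <= M.
  by have [? [_ _ _ /(_ 0)[_ _]]] := jets point; apply: le_trans.
have mf : measurable_fun setT (fun t => F (update (W ^~ t) i (X k t))).
  apply: (mF _ T (fun j t => update (W ^~ t) i (X k t) j)).
  apply: measurable_update => // j ji.
  exact: (measurable_off_weaken mX (mW j ji)).
have if0 : P.-integrable setT (EFin \o (fun t => f t (X k t))).
  exact: integrable_bounded (fun t => FK _).
have ic : P.-integrable setT (EFin \o (f ^~ 0)).
  apply: integrable_bounded (fun t => FK _).
  exact: (measurable_off_weaken mX (mfS 0)).
have mf1 := measurable_off_weaken mX (mf1S 0).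
have mf2 := measurable_off_weaken mX (mf2S 0).
have mf22S : measurable_fun [set: S] (fun t => f2 t 0 / 2).
  by apply: measurable_funM.
have B22 t : `|f2 t 0 / 2| <= B.
  rewrite normrM (@ger0_norm _ 2^-1)//; have := B2 t 0.
  have := normr_ge0 (f2 t 0); lra.
have iM (h V : T -> R) : measurable_fun setT h -> (forall t, `|h t| <= B) ->
    measurable_fun setT V -> P.-integrable setT (EFin \o V) ->
    P.-integrable setT (EFin \o (fun t => h t * V t)).
  move=> mh hB mV iV.
  have : P.-integrable setT (fun t => B%:E * (EFin \o V) t)%E by exact: integrableZl.
  apply: le_integrable => //.
    by apply/measurable_EFinP; exact: measurable_funM.
  move=> t _ /=; rewrite lee_fin !normrM ler_wpM2r//.
  exact: le_trans (hB t) (ler_norm _).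
have mX2 : measurable_fun setT (fun t => X k t ^+ 2) by exact: measurable_funX.
have ia := iM _ _ mf1 (fun t => B1 t 0) (mX k) iX1.
have ib := iM _ _ (measurable_off_weaken mX mf22S) B22 mX2 iX2.
rewrite -(Rintegral_indep_off mX indX (mf1S 0) (fun t =>
    B1 t 0) (@measurable_id _ _ _) iX1).
rewrite -(Rintegral_indep_off (f := fun y => y ^+ 2) mX indX mf22S B22 _ iX2)//.
rewrite -(RintegralD measurableT ic ia).
have iab : P.-integrable setT (EFin \o (fun t => f t 0 + f1 t 0 * X k t)).
  exact: (integrableD measurableT ic ia).
rewrite -(RintegralD measurableT iab ib).
have iabc : P.-integrable setT (EFin \o (fun t => f t 0 + f1 t 0 * X k t + f2 t
    0 / 2 * X k t ^+ 2)).
  exact: (integrableD measurableT iab ib).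
rewrite -(RintegralB measurableT if0 iabc).
have ir : P.-integrable setT (EFin \o (fun t =>
   f t (X k t) - (f t 0 + f1 t 0 * X k t + f2 t 0 / 2 * X k t ^+ 2))).
  exact: (integrableB measurableT if0 iabc).
apply: le_trans (le_normr_Rintegral measurableT ir) _.
rewrite -RintegralZl//; apply: le_Rintegral => //.
- exact: integrable_norm.
- by have := integrableZl measurableT M iX3.
- move=> t _; have [f3 [d1 d2 d3 b]] := jets t.
  by apply: (taylor2_bound d1 d2 d3) => s; have [] := b s.
Qed.

End Lindeberg.

Section LindebergSwap.
Context (R : realType) (I : finType) (d : measure_display).
Context (T : measurableType d) (P : probability T R) (Z Y : I -> T -> R).

Definition sum_family (s : I + I) : T -> R :=
  match s with inl i => Z i | inr i => Y i end.

Hypothesis mZ : forall i, measurable_fun setT (Z i).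
Hypothesis mY : forall i, measurable_fun setT (Y i).
Hypothesis ind : independent_funs P sum_family.

(** Telescoping over hybrid families. Neighbouring hybrids differ in one coordinate, and both
    expectations are compared with the same second-order Taylor expression at 0, the first two
    moments being equal. *)
Lemma lindeberg (F : (I -> R) -> R) (K B M m3 : R) :
  coordinatewise_measurable F -> (forall x, `|F x| <= K) ->
  smooth_coordinates F B M ->
  (forall i, P.-integrable setT (EFin \o (fun t => `|Z i t| ^+ 3))) ->
  (forall i, P.-integrable setT (EFin \o (fun t => `|Y i t| ^+ 3))) ->
  (forall i, \int[P]_t (`|Z i t| ^+ 3) + \int[P]_t (`|Y i t| ^+ 3) <= m3) ->
  (forall i, \int[P]_t Z i t = \int[P]_t Y i t) ->
  (forall i, \int[P]_t (Z i t ^+ 2) = \int[P]_t (Y i t ^+ 2)) ->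
  `| \int[P]_t F (Z ^~ t) - \int[P]_t F (Y ^~ t) | <= #|I|%:R * (M * m3).
Proof.
move=> mF FK sF iZ iY hm3 e1 e2.
have mX s : measurable_fun setT (sum_family s) by case: s.
pose W (s : seq I) i t := if i \in s then Z i t else Y i t.
have step k s : k \notin s ->
    `|\int[P]_t F (W (k :: s) ^~ t) - \int[P]_t F (W s ^~ t)| <= M * m3.
  move=> ks.
  have eZ t : W (k :: s) ^~ t = update (W s ^~ t) k (Z k t).
    by apply/funext => i; rewrite /W /update inE; case: eqP => [->|].
  have eY t : W s ^~ t = update (W s ^~ t) k (Y k t).
    by apply/funext => i; rewrite /W /update; case: eqP => [->|//];
        rewrite (negbTE ks).
  under eq_Rintegral do rewrite eZ.
  under [X in _ - X]eq_Rintegral do rewrite eY.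
  (* The hybrid uses only one of [Z j], [Y j] for each [j], so away from [k] it is measurable both
     off [inl k] and off [inr k]. *)
  have mW (k' : I + I) : (k' = inl k) \/ (k' = inr k) -> forall j, j != k ->
      measurable_fun [set: g_sigma_algebraType (rectangles_off sum_family k')]
          (W s j).
    move=> hk j jk; rewrite /W; case: (j \in s).
      by apply: (@measurable_off _ _ _ _ sum_family k' (inl j)); case: hk => -> //;
        apply: contra jk => /eqP[->].
    by apply: (@measurable_off _ _ _ _ sum_family k' (inr j)); case: hk => -> //;
      apply: contra jk => /eqP[->].
  have H1 := lindeberg_taylor mX ind mF FK sF (mW (inl k) (or_introl erefl)) (iZ k).
  have H2 := lindeberg_taylor mX ind mF FK sF (mW (inr k) (or_intror erefl)) (iY k).
  rewrite /= -e1 -e2 in H1 H2.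
  have M0 : 0 <= M.
    by have [? [? [? [_ _ _ /(_ 0)[_ _]]]]] := sF (fun=> 0) k; apply: le_trans.
  have h3 := ler_wpM2l M0 (hm3 k); rewrite mulrDr in h3.
  apply: (le_trans _ h3); apply: (le_trans _ (lerD H1 H2)).
  rewrite [X in _ <= _ + X]distrC; exact: ler_distD.
have all_s s : uniq s ->
    `|\int[P]_t F (W s ^~ t) - \int[P]_t F (W [::] ^~ t)| <= (size s)%:R * (M * m3).
  elim: s => [_|k s IH /= /andP[ks us]]; first by rewrite subrr normr0 mul0r.
  rewrite -natr1 mulrDl mul1r [leRHS]addrC.
  apply: (le_trans _ (lerD (step k s ks) (IH us))); exact: ler_distD.
have := all_s (enum I) (enum_uniq I); rewrite -cardE.
have -> : W [::] = Y by [].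
have -> // : W (enum I) = Z.
by apply/funext => i; apply/funext => t; rewrite /W mem_enum.
Qed.

End LindebergSwap.

(** * Change of variables and decoupling *)

Section Transfer.
Context (R : realType) (d d' : measure_display).
Context (T : measurableType d) (T' : measurableType d').
Context (P : probability T R) (P' : probability T' R) (phi : T' -> T).
Hypothesis mphi : measurable_fun setT phi.
Hypothesis phiE : forall A, measurable A -> P' (phi @^-1` A) = P A.

Lemma integrable_transfer (f : T -> R) : P.-integrable setT (EFin \o f) ->
  P'.-integrable setT (EFin \o (f \o phi)).
Proof.
pose phi' : {mfun T' >-> T} := HB.pack phi (isMeasurableFun.Build _ _ _ _ phi mphi).
move=> /integrableP[mf fi]; apply/integrableP; split.
  exact: (measurableT_comp mf mphi).
have := @ge0_integral_distribution _ _ _ _ _ P' phi' (fun x => `|(f x)%:E|%E).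
move=> <- //; last by exact: measurableT_comp.
by rewrite (eq_measure_integral P)// => A mA _; exact: phiE.
Qed.

Lemma Rintegral_transfer (f : T -> R) : P.-integrable setT (EFin \o f) ->
  \int[P']_t f (phi t) = \int[P]_t f t.
Proof.
pose phi' : {mfun T' >-> T} := HB.pack phi (isMeasurableFun.Build _ _ _ _ phi mphi).
move=> fi; rewrite /Rintegral; congr fine.
have := @integral_distribution _ _ _ _ _ P' phi' (EFin \o f).
move=> <- //; first by apply: eq_measure_integral => A mA _; exact: phiE.
- by case/integrableP : fi.
- exact: integrable_transfer.
Qed.

End Transfer.

Section Decoupling.
Context (R : realType) (I : finType) (d : measure_display).
Context (T : measurableType d) (P : probability T R) (Z Y : I -> T -> R).
Hypothesis mZ : forall i, measurable_fun setT (Z i).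
Hypothesis mY : forall i, measurable_fun setT (Y i).
Hypothesis indZ : independent_funs P Z.
Hypothesis indY : independent_funs P Y.

Let P2 : probability (T * T)%type R := (P \x P)%E.

Lemma independent_product :
  independent_funs P2
    (sum_family (fun i (t : T * T) => Z i t.1) (fun i (t : T * T) => Y i t.2)).
Proof.
move=> J E mE.
pose JZ := [set i | inl i \in J]%SET; pose JY := [set i | inr i \in J]%SET.
pose CZ := \bigcap_(i in [set` JZ]) Z i @^-1` E (inl i).
pose CY := \bigcap_(i in [set` JY]) Y i @^-1` E (inr i).
have mCZ : measurable CZ.
  apply: fin_bigcap_measurable; first exact: finite_finset.
  by move=> i _; rewrite -[_ @^-1` _]setTI; exact: mZ.
have mCY : measurable CY.
  apply: fin_bigcap_measurable; first exact: finite_finset.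
  by move=> i _; rewrite -[_ @^-1` _]setTI; exact: mY.
(* An intersection indexed by [I + I] is a rectangle in [T * T], whose measure factorizes. *)
rewrite [X in P2 X](_ : _ = CZ `*` CY); last first.
  apply/seteqP; split=> -[t s] /=.
  - move=> h; split=> i /=; rewrite inE => iJ; first exact: (h (inl i)).
    exact: (h (inr i)).
  - move=> [hZ hY] [i|i] iJ /=; first by apply: (hZ i); rewrite /= inE.
    by apply: (hY i); rewrite /= inE.
have -> : P2 (CZ `*` CY) = (P CZ * P CY)%E by exact: product_measure1E.
rewrite indZ// indY// big_sumType/=.
have P2Z A : measurable A -> (P \x P)%E [set t | A t.1] = P A.
  move=> mA; rewrite (_ : [set t | A t.1] = A `*` setT).
    by rewrite product_measure1E// [X in (_ * X)%E]probability_setT mule1.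
  by apply/seteqP; split=> -[t s] //= [].
have P2Y A : measurable A -> (P \x P)%E [set t | A t.2] = P A.
  move=> mA; rewrite (_ : [set t | A t.2] = setT `*` A).
    by rewrite product_measure1E// [X in (X * _)%E]probability_setT mul1e.
  by apply/seteqP; split=> -[t s] //= [].
congr (_ * _)%E; apply: eq_big => i; rewrite ?inE// => _.
- rewrite -(P2Z (Z i @^-1` E (inl i)))// -[_ @^-1` _]setTI; exact: mZ.
- rewrite -(P2Y (Y i @^-1` E (inr i)))// -[_ @^-1` _]setTI; exact: mY.
Qed.

(* Only the two laws matter, so [Z] and [Y] can be made jointly independent by
   putting them on the two factors of [T * T]. *)
Lemma lindeberg_decoupled (F : (I -> R) -> R) (K B M m3 : R) :
  coordinatewise_measurable F -> (forall x, `|F x| <= K) ->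
  smooth_coordinates F B M ->
  (forall i, P.-integrable setT (EFin \o (fun t => `|Z i t| ^+ 3))) ->
  (forall i, P.-integrable setT (EFin \o (fun t => `|Y i t| ^+ 3))) ->
  (forall i, \int[P]_t (`|Z i t| ^+ 3) + \int[P]_t (`|Y i t| ^+ 3) <= m3) ->
  (forall i, \int[P]_t Z i t = \int[P]_t Y i t) ->
  (forall i, \int[P]_t (Z i t ^+ 2) = \int[P]_t (Y i t ^+ 2)) ->
  `| \int[P]_t F (Z ^~ t) - \int[P]_t F (Y ^~ t) | <= #|I|%:R * (M * m3).
Proof.
move=> mF FK sF iZ iY hm3 e1 e2.
have m1 := @measurable_fst _ _ T T; have m2 := @measurable_snd _ _ T T.
have E1 A : measurable A -> P2 (fst @^-1` A) = P A.
  move=> mA; rewrite (_ : _ @^-1` A = A `*` setT).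
    by rewrite -[RHS]mule1 -(probability_setT P); exact: product_measure1E.
  by apply/seteqP; split=> -[t s] //= [].
have E2 A : measurable A -> P2 (snd @^-1` A) = P A.
  move=> mA; rewrite (_ : _ @^-1` A = setT `*` A).
    by rewrite -[RHS]mul1e -(probability_setT P); exact: product_measure1E.
  by apply/seteqP; split=> -[t s] //= [].
have T1 := Rintegral_transfer m1 E1; have T2 := Rintegral_transfer m2 E2.
have iFZ : P.-integrable setT (EFin \o (fun t => F (Z ^~ t))).
  by apply: (@integrable_bounded _ _ _ _ _ K) => //; exact: mF.
have iFY : P.-integrable setT (EFin \o (fun t => F (Y ^~ t))).
  by apply: (@integrable_bounded _ _ _ _ _ K) => //; exact: mF.
rewrite -(T1 _ iFZ) -(T2 _ iFY).
apply: (lindeberg (P := P2) (Z := fun i t => Z i t.1) (Y := fun i t =>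
    Y i t.2)) mF FK sF _ _ _ _ _.
- by move=> i; exact: measurableT_comp.
- by move=> i; exact: measurableT_comp.
- exact: independent_product.
- by move=> i; exact: (integrable_transfer m1 E1 (iZ i)).
- by move=> i; exact: (integrable_transfer m2 E2 (iY i)).
- by move=> i; rewrite (T1 _ (iZ i)) (T2 _ (iY i)).
- move=> i; have [iz _] := integrable_powers (mZ i) (iZ i).
  have [iy _] := integrable_powers (mY i) (iY i).
  by rewrite (T1 (Z i) iz) (T2 (Y i) iy).
- move=> i; have [_ iz] := integrable_powers (mZ i) (iZ i).
  have [_ iy] := integrable_powers (mY i) (iY i).
  by rewrite (T1 _ iz) (T2 _ iy).
Qed.

End Decoupling.

(** * Soft max-min *)

Section SoftMaxMin.
Context (R : realType).

Lemma ln_sum_ge (U : finType) (e : U -> R) (u : U) : (forall u, 0 < e u) ->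
  ln (e u) <= ln (\sum_v e v).
Proof.
move=> e0; have le : e u <= \sum_v e v.
  by rewrite (bigD1 u)//= lerDl sumr_ge0// => v _; exact/ltW/e0.
by rewrite ler_ln// posrE// (lt_le_trans _ le).
Qed.

Lemma ln_sum_le (U : finType) (e : U -> R) (u0 : U) : (forall u, 0 < e u) ->
  exists u, ln (\sum_v e v) <= ln #|U|%:R + ln (e u).
Proof.
move=> e0; have [u _ hu] := @arg_maxP _ _ _ u0 predT e isT.
have U0 : 0 < #|U|%:R :> R by rewrite ltr0n; apply/card_gt0P; exists u0.
exists u; rewrite -lnM ?posrE// ler_ln ?posrE ?mulr_gt0//; last first.
  by apply: (lt_le_trans (e0 u0)); rewrite (bigD1 u0)//= lerDl sumr_ge0// =>
      v _; exact/ltW.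
rewrite mulrC mulr_natr -sumr_const; apply: ler_sum => v _; exact: hu.
Qed.

Context (U W : finType) (u0 : U) (w0 : W) (b : R).
Hypothesis b0 : 0 < b.
Implicit Type v : U -> W -> R.

Definition partition_sum v u : R := \sum_w expR (- b * v u w).

Definition soft_min v u : R := - b^-1 * ln (partition_sum v u).

(** Since [(partition_sum v u)^-1] equals [expR (b * soft_min v u)], this is the log-sum-exp of the
    soft minima. Using the same [b] at both levels removes the inner logarithm. *)
Definition soft_max_min v : R := b^-1 * ln (\sum_u (partition_sum v u)^-1).

Lemma partition_sum_gt0 v u : 0 < partition_sum v u.
Proof.
by rewrite /partition_sum (bigD1 w0)//= ltr_pwDl ?expR_gt0// sumr_ge0//.
Qed.

Lemma soft_min_le v u w : soft_min v u <= v u w.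
Proof.
rewrite /soft_min mulNr lerNl -(@ler_pM2l _ b)// mulVKf ?gt_eqF//.
rewrite mulrN -mulNr -{1}[- b * _]expRK.
by apply: (@ln_sum_ge _ (fun w => expR (- b * v u w))) => w'; exact: expR_gt0.
Qed.

Lemma soft_min_ge v u : exists w, v u w <= soft_min v u + b^-1 * ln #|W|%:R.
Proof.
have [w] := @ln_sum_le _ (fun w => expR (- b * v u w)) w0 (fun w => expR_gt0 _).
rewrite expRK => h; exists w.
rewrite /soft_min mulNr -lerBlDl opprK -(@ler_pM2l _ b)// mulrDr !mulVKf ?gt_eqF//.
by rewrite /partition_sum; lra.
Qed.

Let ln_inv v u : ln (partition_sum v u)^-1 = b * soft_min v u.
Proof.
by rewrite lnV ?posrE ?partition_sum_gt0// /soft_min mulrA mulrN divff ?gt_eqF//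
    mulN1r.
Qed.

Lemma soft_max_min_ge v u : soft_min v u <= soft_max_min v.
Proof.
rewrite /soft_max_min -(@ler_pM2l _ b)// mulVKf ?gt_eqF// -ln_inv.
apply: (@ln_sum_ge _ (fun u => (partition_sum v u)^-1)) => u'.
by rewrite invr_gt0 partition_sum_gt0.
Qed.

Lemma soft_max_min_le v : exists u,
  soft_max_min v <= soft_min v u + b^-1 * ln #|U|%:R.
Proof.
have [|u h] := @ln_sum_le _ (fun u => (partition_sum v u)^-1) u0.
  by move=> u; rewrite invr_gt0 partition_sum_gt0.
exists u; rewrite /soft_max_min -(@ler_pM2l _ b)// mulrDr !mulVKf ?gt_eqF//.
by rewrite -ln_inv addrC.
Qed.

End SoftMaxMin.

(** [x] stands for the matrix entries. [U] and [W] are arbitrary types because the same form serves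
    the original sets and their finite nets. *)
Definition affine_payoff (R : realType) (I : finType) (U W : Type)
    (q : U -> W -> R) (c : U -> W -> I -> R) (x : I -> R) u w : R :=
  q u w + \sum_i c u w i * x i.

Section SoftMaxMinSmooth.
Context (R : realType) (I U W : finType) (u0 : U) (w0 : W).
Context (q : U -> W -> R) (c : U -> W -> I -> R) (a : R).
Hypothesis ca : forall u w i, `|c u w i| <= a.

(* The constants of [log_jetV] and [smooth_jet_ln] applied to sums of
   exponentials. *)
Definition smooth_cst : R := 6 * (13 * 1 ^+ 3) ^+ 3.

(** In one coordinate every exponent is affine with slope at most [b * a]. The soft value then
    arises by a sum over [w], an inverse, a sum over [u] and a logarithm, each of which preserves
    the jet bounds. *)
Lemma soft_max_min_jet (b : R) (x : I -> R) (k : I) : 0 < b ->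
  exists f1 f2 f3, smooth_jet (smooth_cst * a) b
    (fun s => soft_max_min b (affine_payoff q c (update x k s))) f1 f2 f3.
Proof.
move=> b0; have a0 : 0 <= a by exact: le_trans (normr_ge0 _) (ca u0 w0 k).
pose p u w := - b * (q u w + \sum_(i | i != k) c u w i * x i).
pose r u w := - b * c u w k.
have E u w s : - b * affine_payoff q c (update x k s) u w = p u w + r u w * s.
  rewrite /affine_payoff (bigD1 k)//= /update eqxx.
  rewrite (eq_bigr (fun i => c u w i * x i)); last by move=> i /negbTE ->.
  by rewrite /p /r; ring.
have rb u w : `|r u w| <= b * a.
  by rewrite /r normrM normrN (gtr0_norm b0) ler_wpM2l// ltW.
pose h u s := \sum_w expR (p u w + r u w * s).
have J u : exists k1 k2 k3, log_jet (13 * 1 ^+ 3) (b * a) (fun s =>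
    (h u s)^-1) k1 k2 k3.
  apply: log_jetV => //; first by rewrite mulr_ge0// ltW.
  exact: (log_jet_sum w0 (fun w => log_jet_exp (p u w) (rb u w))).
have [k1 /choice[k2 /choice[k3 J3]]] := choice J.
have J4 := log_jet_sum u0 J3.
have [|f1 [f2 [f3 Jf]]] := smooth_jet_ln _ a0 b0 J4.
  by lra.
exists f1, f2, f3; move: Jf; congr (smooth_jet _ _ _ _ _ _).
apply/funext => s; rewrite /soft_max_min; congr (_ * ln _); apply: eq_bigr => u _.
by congr (_^-1); apply: eq_bigr => w _; rewrite E.
Qed.

Lemma soft_max_min_measurable (b : R) :
  coordinatewise_measurable (fun x => soft_max_min b (affine_payoff q c x)).
Proof.
move=> d T X mX; apply: measurable_funM => //.
apply: measurableT_comp; first exact: measurable_ln.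
apply: measurable_sum => u.
(* The inverse of a positive quantity is written through [expR] and [ln], whose measurability is at
   hand. *)
have -> : (fun t => (partition_sum b (affine_payoff q c (X ^~ t)) u)^-1) =
    (fun t => expR (- ln (partition_sum b (affine_payoff q c (X ^~ t)) u))).
  apply/funext => t; have h := partition_sum_gt0 w0 b (affine_payoff q c (X ^~ t)) u.
  by rewrite expRN lnK.
apply: measurableT_comp; first exact: measurable_expR.
apply: measurable_funN; apply: measurableT_comp; first exact: measurable_ln.
apply: measurable_sum => w; apply: measurableT_comp; first exact: measurable_expR.
apply: measurable_funM => //; apply: measurable_funD => //.
apply: measurable_sum => i; exact: measurable_funM.
Qed.

End SoftMaxMinSmooth.

(** * Smooth approximation of optimal values *)

Lemma affine_payoffN (R : realType) (I : finType) (U W : Type)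
    (q : U -> W -> R) c (x : I -> R) :
  (fun u w => - affine_payoff q c x u w) =
  affine_payoff (fun u w => - q u w) (fun u w i => - c u w i) x.
Proof.
apply/funext => u; apply/funext => w; rewrite /affine_payoff opprD; congr (_ + _).
by rewrite -sumrN; apply: eq_bigr => i _; rewrite mulNr.
Qed.

Lemma min_maxE (R : realType) (U W : Type) (A : set U) (B : set W)
    (F : U -> W -> R) :
  min_max A B F = (- max_min A B (fun u w => - F u w)%R)%E.
Proof.
rewrite /max_min /min_max -ereal_infN; congr ereal_inf.
rewrite image_comp; congr image; apply/funext => u /=.
rewrite -ereal_supN; congr ereal_sup; rewrite image_comp.
by congr image; apply/funext => w /=; rewrite ?EFinN ?oppeK.
Qed.

Section SmoothApproximation.
Context (R : realType) (I : finType).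

(* [err] is the discretization and soft-max error at [x = 0]; [kap] and [a]
   are Lipschitz constants for the l^1 norm. *)
Definition smoothly_approximable (V : (I -> R) -> \bar R) (err kap a b : R) :=
  exists v F : (I -> R) -> R,
  [/\ forall x, V x = (v x)%:E,
      forall x, `|v x - F x| <= err + kap * \sum_i `|x i|,
      forall x y, `|v x - v y| <= a * \sum_i `|x i - y i|,
      forall x k, exists f1 f2 f3,
        smooth_jet (smooth_cst R * a) b (fun s => F (update x k s)) f1 f2 f3 &
      coordinatewise_measurable F].

Lemma smoothly_approximableN V err kap a b :
  smoothly_approximable V err kap a b ->
  smoothly_approximable (fun x => - V x)%E err kap a b.
Proof.
move=> [v [F [hv hF hL hS hM]]].
exists (fun x => - v x), (fun x => - F x); split=> [x|x|x y|x k|].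
- by rewrite hv.
- by rewrite -opprD normrN.
- by rewrite -opprD normrN.
- have [f1 [f2 [f3 J]]] := hS x k.
  by do 3 eexists; exact: smooth_jetN J.
- by move=> d T X mX; apply: measurable_funN; exact: hM.
Qed.

Lemma smoothly_approximable_weaken V e e' kap a b : e <= e' ->
  smoothly_approximable V e kap a b -> smoothly_approximable V e' kap a b.
Proof.
move=> ee [v [F [h1 h2 h3 h4 h5]]]; exists v, F; split=> // x.
by apply: (le_trans (h2 x)); rewrite lerD2r.
Qed.

Context (U W : Type) (Su : set U) (Sw : set W).

Lemma le_max_min (F G : U -> W -> R) (e : R) :
  (forall u w, Su u -> Sw w -> F u w <= G u w + e) ->
  (max_min Su Sw F <= max_min Su Sw G + e%:E)%E.
Proof.
move=> FG; apply: ge_ereal_sup => _ [u Suu <-].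
rewrite -leeBlDr//; apply: le_ereal_sup_tmp; eexists; first by exists u.
apply: le_ereal_inf_tmp => _ [w Sww <-].
rewrite leeBlDr// -EFinD; apply: (@le_trans _ _ (F u w)%:E); last first.
  by rewrite lee_fin FG.
by apply: ereal_inf_lbound; exists w.
Qed.

Context (CU CW : finType) (cu : CU) (cw : CW).
Context (ru : CU -> U) (pu : U -> CU) (rw : CW -> W) (pw : W -> CW).
Hypothesis Sru : forall c, Su (ru c).
Hypothesis Srw : forall c, Sw (rw c).

(** [ru] and [rw] give net points in the sets; [pu] and [pw] round to the net. From above, the
    minimizer is restricted to the net and [u] is rounded; from below, [u] is the best net point and
    [w] is rounded. Hence each hypothesis moves one variable while the other stays on the net. The
    two bounds also show that the value is finite. *)
Lemma max_min_soft (F : U -> W -> R) (b e : R) : 0 < b ->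
  (forall u c, Su u -> `|F u (rw c) - F (ru (pu u)) (rw c)| <= e) ->
  (forall c w, Sw w -> `|F (ru c) w - F (ru c) (rw (pw w))| <= e) ->
  exists2 v, max_min Su Sw F = v%:E &
    `|v - soft_max_min b (fun c c' => F (ru c) (rw c'))|
       <= e + b^-1 * (ln #|CU|%:R + ln #|CW|%:R).
Proof.
move=> b0 hu hw; set f := fun c c' => F (ru c) (rw c').
set s := soft_max_min b f.
have bi0 : 0 <= b^-1 by rewrite invr_ge0 ltW.
have lnU : 0 <= b^-1 * ln #|CU|%:R.
  by rewrite mulr_ge0// ln_ge0// ler1n; apply/card_gt0P; exists cu.
have lnW : 0 <= b^-1 * ln #|CW|%:R.
  by rewrite mulr_ge0// ln_ge0// ler1n; apply/card_gt0P; exists cw.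
have ub : (max_min Su Sw F <= (s + (e + b^-1 * (ln #|CU|%:R + ln #|CW|%:R)))%:E)%E.
  apply: ge_ereal_sup => _ [u Suu <-].
  have [w h] := soft_min_ge cw b0 f (pu u).
  apply: ge_ereal_inf; exists (F u (rw w))%:E; first by exists (rw w).
  have h2 := soft_max_min_ge cw b0 f (pu u).
  have := hu u w Suu; rewrite ler_norml => /andP[_].
  rewrite lee_fin mulrDr -/(f (pu u) w) -/s in h h2 *; lra.
have lb : ((s - (e + b^-1 * (ln #|CU|%:R + ln #|CW|%:R)))%:E <= max_min Su Sw F)%E.
  have [c h] := soft_max_min_le cu cw b0 f.
  apply: le_ereal_sup_tmp; eexists; first by exists (ru c).
  apply: le_ereal_inf_tmp => _ [w Sww <-]; rewrite lee_fin.
  have h2 := soft_min_le b0 f c (pw w).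
  have := hw c w Sww; rewrite ler_norml => /andP[+ _].
  rewrite mulrDr -/(f c (pw w)) -/s in h h2 *; lra.
case: (max_min Su Sw F) ub lb => [v| |]//; rewrite !lee_fin => ub lb.
exists v => //; rewrite ler_norml; lra.
Qed.

Context (q : U -> W -> R) (c : U -> W -> I -> R) (o kap a b : R).
Hypothesis b0 : 0 < b.
Hypothesis ca : forall u w i, Su u -> Sw w -> `|c u w i| <= a.
Hypothesis qu : forall u k, Su u -> `|q u (rw k) - q (ru (pu u)) (rw k)| <= o.
Hypothesis qw : forall k w, Sw w -> `|q (ru k) w - q (ru k) (rw (pw w))| <= o.
Hypothesis cu_kap : forall u k i, Su u ->
  `|c u (rw k) i - c (ru (pu u)) (rw k) i| <= kap.
Hypothesis cw_kap : forall k w i, Sw w ->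
  `|c (ru k) w i - c (ru k) (rw (pw w)) i| <= kap.

Lemma affine_payoff_close u w u' w' x :
  `|q u w - q u' w'| <= o -> (forall i, `|c u w i - c u' w' i| <= kap) ->
  `|affine_payoff q c x u w - affine_payoff q c x u' w'|
    <= o + kap * \sum_i `|x i|.
Proof.
move=> hq hc; rewrite /affine_payoff opprD addrACA.
apply: (le_trans (ler_normD _ _)); apply: lerD => //.
rewrite -sumrB mulr_sumr; apply: (le_trans (ler_norm_sum _ _ _)).
by apply: ler_sum => i _; rewrite -mulrBl normrM ler_wpM2r.
Qed.

Lemma max_min_approximable :
  smoothly_approximable (fun x => max_min Su Sw (affine_payoff q c x))
    (o + b^-1 * (ln #|CU|%:R + ln #|CW|%:R)) kap a b.
Proof.
have /choice[v hv] : forall x, exists v, max_min Su Sw (affine_payoff q c x) = v%:E /\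
    `|v - soft_max_min b (fun k l => affine_payoff q c x (ru k) (rw l))|
    <= o + kap * \sum_i `|x i| + b^-1 * (ln #|CU|%:R + ln #|CW|%:R).
  move=> x.
  have [||v] := @max_min_soft (affine_payoff q c x) b (o + kap * \sum_i `|x i|) b0.
  - move=> u k Suu; apply: affine_payoff_close; first exact: qu.
    by move=> i; exact: cu_kap.
  - move=> k w Sww; apply: affine_payoff_close; first exact: qw.
    by move=> i; exact: cw_kap.
  by move=> h1 h2; exists v.
pose q' k l := q (ru k) (rw l); pose c' k l := c (ru k) (rw l).
have ca' k l i : `|c' k l i| <= a by exact: ca.
exists v, (fun x => soft_max_min b (affine_payoff q' c' x)); split.
- by move=> x; have [] := hv x.
- by move=> x; rewrite addrAC; have [] := hv x.
(* The Lipschitz bound concerns the exact value, not its soft version; measurability of the exact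
   value will come from it. *)
- have lip x y : v x <= v y + a * \sum_i `|x i - y i|.
    rewrite -lee_fin EFinD; have [<- _] := hv x; have [<- _] := hv y.
    apply: le_max_min => u w Suu Sww.
    rewrite -lerBlDl; apply: (le_trans (ler_norm _)).
    rewrite /affine_payoff opprD addrACA subrr add0r -sumrB mulr_sumr.
    apply: (le_trans (ler_norm_sum _ _ _)); apply: ler_sum => i _.
    by rewrite -mulrBr normrM ler_wpM2r// ca.
  move=> x y; rewrite ler_norml; have := lip x y; have := lip y x.
  rewrite (eq_bigr (fun i => `|x i - y i|)); last by move=> i _; rewrite distrC.
  lra.
- by move=> x k; exact: soft_max_min_jet.
- exact: soft_max_min_measurable.
Qed.

End SmoothApproximation.

(** * Finite nets inside subsets of a cube *)

Section CubeNet.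
Context (R : realType) (k : nat).
Implicit Types (S : set 'cV[R]_k) (u : 'cV[R]_k).

(* One representative in [S] for each cell of side [delta] that meets [S];
   cells missing [S] are sent to an arbitrary point of [S]. *)
Lemma cube_net S (L delta : R) :
  S !=set0 -> S `<=` cube L -> 0 < delta -> 2 <= L / delta ->
  exists (C : finType) (c0 : C) (r : C -> 'cV[R]_k) (p : 'cV[R]_k -> C),
  [/\ forall c, S (r c),
      forall u i, S u -> `|u i ord0 - r (p u) i ord0| <= delta &
      ln #|C|%:R <= 3 * k%:R * ln (L / delta)].
Proof.
move=> [u0 Su0] SL d0 y2; set y := L / delta in y2 *.
(* On the cube, [(u i ord0 + L) / delta] lies between 0 and [2 * y], so its integer part is at most
   [K] and [inord] never falls back to its default. *)
pose K := Num.truncn (2 * y).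
pose cell u := [ffun i : 'I_k => inord (Num.truncn ((u i ord0 + L) / delta)) :
    'I_K.+1].
pose r c := xget u0 [set u | S u /\ cell u = c].
have Sr c : S (r c).
  by rewrite /r; case: xgetP => [u _ []|].
exists {ffun 'I_k -> 'I_K.+1}, (cell u0), r, cell; split=> //.
- move=> u i Suu.
  have [Sv ev] : S (r (cell u)) /\ cell (r (cell u)) = cell u.
    by apply: (xgetPex u0 (P := [set v | S v /\ cell v = cell u])); exists u.
  set v := r (cell u) in Sv ev *.
  have bnd w : S w -> 0 <= (w i ord0 + L) / delta <= 2 * y.
    move=> /SL/(_ i)/andP[h1 h2]; rewrite divr_ge0 ?(ltW d0)//=; last by lra.
    by rewrite /y mulrA ler_wpM2r ?invr_ge0 ?(ltW d0)//; lra.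
  have tr w : S w -> nat_of_ord (cell w i) = Num.truncn ((w i ord0 + L) / delta).
    move=> Sw; rewrite ffunE inordK// ltnS; apply: le_truncn.
    by have /andP[] := bnd _ Sw.
  have e : Num.truncn ((v i ord0 + L) / delta) = Num.truncn ((u i ord0 + L) / delta).
    by rewrite -tr// -tr// ev.
  have /andP[bu0 _] := bnd _ Suu; have /andP[bv0 _] := bnd _ Sv.
  have /andP[a1 a2] := truncn_itv bu0; have /andP[b1 b2] := truncn_itv bv0.
  rewrite e in b1 b2; rewrite -natr1 in a2 b2.
  have -> : u i ord0 - v i ord0 =
      ((u i ord0 + L) / delta - (v i ord0 + L) / delta) * delta.
    by field; rewrite gt_eqF.
  rewrite normrM (gtr0_norm d0) ler_piMl ?(ltW d0)// ler_norml; lra.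
- rewrite card_ffun !card_ord natrX lnXn// -[leLHS]mulr_natr [leRHS]mulrAC
      ler_wpM2r//.
  (* For [2 <= y] one has [K + 1 <= 2 * y + 1 <= 4 * y <= y ^+ 3]: each coordinate contributes at
     most [3 * ln y]. *)
  have -> : 3 * ln y = ln (y ^+ 3) by rewrite lnXn; [rewrite mulr_natl|lra].
  have K1 : K.+1%:R <= 2 * y + 1.
    by rewrite -natr1 lerD2r truncn_le; lra.
  have y3 : 4 * y <= y ^+ 3.
    by rewrite exprSr ler_wpM2r//; [lra|have := lerXn2r 2 (ler0n _ 2) (le_trans
        (ler0n _ 2) y2) y2; lra].
  by rewrite ler_ln ?posrE//; [lra|rewrite exprn_gt0//; lra].
Qed.

End CubeNet.

(** * The optimal value as a function of the matrix entries *)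

Section OptimalValue.
Context (R : realType) (m n : nat).
Implicit Types (Q : 'cV[R]_m -> 'cV[R]_n -> R).
Local Notation I := ('I_m * 'I_n)%type.

Definition bilinear_coef (u : 'cV[R]_m) (w : 'cV[R]_n) (ij : I) : R :=
  m%:R^-1 * (Num.sqrt m%:R)^-1 * (u ij.1 ord0 * w ij.2 ord0).

Lemma Xn_scaled_mx (d : measure_display) (T : measurableType d)
    (P : probability T R) (A : 'I_m -> 'I_n -> {RV P >-> R}) Q t :
  Xn Q (scaled_mx A t) =
  affine_payoff Q bilinear_coef (fun ij => A ij.1 ij.2 t).
Proof.
apply/funext => u; apply/funext => w; rewrite /Xn /affine_payoff addrC; congr (_ + _).
rewrite /scaled_mx -scalemxAr -scalemxAl mxE mulrA.
rewrite !mxE mulr_sumr.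
under eq_bigr do rewrite mxE mulr_suml mulr_sumr.
rewrite exchange_big pair_big/=; apply: eq_bigr => -[i j] _ /=.
by rewrite /bilinear_coef !mxE /=; ring.
Qed.

Lemma mx_norm_le p q (x : 'M[R]_(p, q)) (e : R) :
  0 <= e -> (forall i j, `|x i j| <= e) -> `|x| <= e.
Proof.
move=> e0 h; rewrite [`|x|](_ : _ = mx_norm x)// mx_normrE.
apply: (big_ind (fun y => y <= e)) => // y z ye ze.
by rewrite ge_max ye.
Qed.

Lemma osc_bound Q (L delta o : R) u u' w w' : osc Q L delta = o%:E ->
  cube L u -> cube L u' -> cube L w -> cube L w' ->
  0 <= delta ->
  (forall i, `|u i ord0 - u' i ord0| <= delta) ->
  (forall i, `|w i ord0 - w' i ord0| <= delta) ->
  `|Q u w - Q u' w'| <= o.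
Proof.
move=> osco cu cu' cw cw' d0 hu hw; rewrite -lee_fin -osco.
apply: ereal_sup_ubound; exists u, u', w, w'; split=> //.
by rewrite ge_max !mx_norm_le// => i j; rewrite ord1 !mxE.
Qed.

Context (Lu Lw : R) (Su : set 'cV[R]_m) (Sw : set 'cV[R]_n).
Hypotheses (Lu1 : 1 <= Lu) (Lw1 : 1 <= Lw).
Hypotheses (SuL : Su `<=` cube Lu) (SwL : Sw `<=` cube Lw).
Hypotheses (Su0 : Su !=set0) (Sw0 : Sw !=set0).
Local Notation L := (Lu + Lw).

(** A min-max is minus the max-min of the negated payoff. All estimates are invariant under this
    sign change and under exchanging the players, so the soft max-min covers the three forms of
    [V]. *)
Lemma optimal_value_approximable Q (delta o b : R) V : (0 < m)%N ->
  0 < delta <= 1 -> osc Q L delta = o%:E -> 0 < b ->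
  [\/ V = max_min Su Sw, V = min_max Su Sw | V = min_max_swap Su Sw] ->
  smoothly_approximable (fun x => V (affine_payoff Q bilinear_coef x))
    (o + b^-1 * (3 * (m%:R + n%:R) * ln (L / delta)))
    (m%:R^-1 * (Num.sqrt m%:R)^-1 * (delta * L))
    (m%:R^-1 * (Num.sqrt m%:R)^-1 * L ^+ 2) b.
Proof.
move=> m0 /andP[d0 d1] osco b0 hV.
have L2 : 2 <= L by move: Lu1 Lw1; lra.
have y2 : 2 <= L / delta.
  by rewrite ler_pdivlMr//; apply: (le_trans _ L2); lra.
have SuL' : Su `<=` cube L.
  by move=> u /SuL h i; have /andP[h1 h2] := h i; apply/andP; split;
      move: Lu1 Lw1; lra.
have SwL' : Sw `<=` cube L.
  by move=> u /SwL h i; have /andP[h1 h2] := h i; apply/andP; split;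
      move: Lu1 Lw1; lra.
have [CU [cu [ru [pu [Sru hru cardU]]]]] := cube_net Su0 SuL' d0 y2.
have [CW [cw [rw [pw [Srw hrw cardW]]]]] := cube_net Sw0 SwL' d0 y2.
set g := m%:R^-1 * (Num.sqrt m%:R)^-1.
have g0 : 0 <= g by rewrite mulr_ge0// invr_ge0 ?sqrtr_ge0.
have nu u i : Su u -> `|u i ord0| <= L.
  by move=> /SuL'/(_ i); rewrite ler_norml.
have nw w i : Sw w -> `|w i ord0| <= L.
  by move=> /SwL'/(_ i); rewrite ler_norml.
have ca u w i : Su u -> Sw w -> `|bilinear_coef u w i| <= g * L ^+ 2.
  move=> Suu Sww; rewrite /bilinear_coef normrM (ger0_norm g0) ler_wpM2l// normrM.
  by rewrite expr2 ler_pM// ?nu// nw.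
have qu u w : Su u -> Sw w -> `|Q u w - Q (ru (pu u)) w| <= o.
  move=> Suu Sww; apply: (osc_bound osco) => //; try exact: ltW.
  - exact: SuL'.
  - exact: SuL'.
  - exact: SwL'.
  - exact: SwL'.
  - by move=> i; exact: hru.
  - by move=> i; rewrite subrr normr0 ltW.
have qw u w : Su u -> Sw w -> `|Q u w - Q u (rw (pw w))| <= o.
  move=> Suu Sww; apply: (osc_bound osco) => //; try exact: ltW.
  - exact: SuL'.
  - exact: SuL'.
  - exact: SwL'.
  - exact: SwL'.
  - by move=> i; rewrite subrr normr0 ltW.
  - by move=> i; exact: hrw.
have cuk u w i : Su u -> Sw w ->
    `|bilinear_coef u w i - bilinear_coef (ru (pu u)) w i| <= g * (delta * L).
  move=> Suu Sww; rewrite -mulrBr normrM (ger0_norm g0) ler_wpM2l// -mulrBl normrM.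
  by rewrite ler_pM// ?hru// nw.
have cwk u w i : Su u -> Sw w ->
    `|bilinear_coef u w i - bilinear_coef u (rw (pw w)) i| <= g * (delta * L).
  move=> Suu Sww; rewrite -mulrBr normrM (ger0_norm g0) ler_wpM2l// -mulrBr normrM.
  by rewrite mulrC ler_pM// ?hrw// nu.
have cardUW : b^-1 * (ln #|CU|%:R + ln #|CW|%:R) <= b^-1 * (3 * (m%:R + n%:R) *
    ln (L / delta)).
  rewrite ler_wpM2l ?invr_ge0 ?(ltW b0)//; apply: (le_trans (lerD cardU cardW)).
  by rewrite -mulrDl -mulrDr.
have N (x y : R) : `|- x - - y| = `|x - y| by rewrite -opprD normrN.
case: hV => ->.
- apply: (smoothly_approximable_weaken (e := o + b^-1 * (ln #|CU|%:R + ln #|CW|%:R))).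
    by rewrite lerD2l.
  apply: (@max_min_approximable _ _ _ _ _ _ _ _ cu cw ru pu rw pw) => //.
  + by move=> u k Suu; exact: qu.
  + by move=> k w Sww; exact: qw.
  + by move=> u k i Suu; exact: cuk.
  + by move=> k w i Sww; exact: cwk.
- apply: (smoothly_approximable_weaken (e := o + b^-1 * (ln #|CU|%:R + ln #|CW|%:R))).
    by rewrite lerD2l.
  under [X in smoothly_approximable X]funext do rewrite min_maxE affine_payoffN.
  apply: smoothly_approximableN.
  apply: (@max_min_approximable _ _ _ _ _ _ _ _ cu cw ru pu rw pw) => //.
  + by move=> u w i Suu Sww; rewrite normrN; exact: ca.
  + by move=> u k Suu; rewrite N; exact: qu.
  + by move=> k w Sww; rewrite N; exact: qw.
  + by move=> u k i Suu; rewrite N; exact: cuk.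
  + by move=> k w i Sww; rewrite N; exact: cwk.
- apply: (smoothly_approximable_weaken (e := o + b^-1 * (ln #|CW|%:R + ln #|CU|%:R))).
    by rewrite lerD2l [X in _ * X]addrC.
  (* With [w] as the outer player, [min_max_swap] is a plain [min_max], and the two nets trade
     places. *)
  pose Q' w u := Q u w; pose c' w u := bilinear_coef u w.
  have -> : (fun x => min_max_swap Su Sw (affine_payoff Q bilinear_coef x)) =
    (fun x => min_max Sw Su (affine_payoff Q' c' x)) by [].
  under [X in smoothly_approximable X]funext do rewrite min_maxE affine_payoffN.
  apply: smoothly_approximableN.
  apply: (@max_min_approximable _ _ _ _ _ _ _ _ cw cu rw pw ru pu) => //.
  + by move=> w u i Sww Suu; rewrite normrN; exact: ca.
  + by move=> w k Sww; rewrite N; exact: qw.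
  + by move=> k u Suu; rewrite N; exact: qu.
  + by move=> w k i Sww; rewrite N; exact: cwk.
  + by move=> k u i Suu; rewrite N; exact: cuk.
Qed.

End OptimalValue.

(** * The quantitative comparison *)

Section LipschitzMeasurable.
Context (R : realType) (I : finType).

(** A Lipschitz [v] is the infimum over rational points [q] of [v q] plus a constant times the l^1
    distance to [q]; its strict sublevel sets are thus countable unions of measurable sets. *)
Lemma lipschitz_measurable (v : (I -> R) -> R) (a : R) :
  (forall x y, `|v x - v y| <= a * \sum_i `|x i - y i|) ->
  coordinatewise_measurable v.
Proof.
move=> va d T X mX.
pose c : R := `|a| + 1.
have c0 : 0 < c by rewrite ltr_wpDl.
have vc x y : v x <= v y + c * \sum_i `|x i - y i|.
  have := le_trans (ler_norm _) (va x y).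
  have s0 : 0 <= \sum_i `|x i - y i| by exact: sumr_ge0.
  have : a * \sum_i `|x i - y i| <= c * \sum_i `|x i - y i|.
    by rewrite ler_wpM2r// (le_trans (ler_norm a))// lerDl.
  lra.
pose qx (q : {ffun I -> rat}) : I -> R := fun i => ratr (q i).
pose A z q := [set t | v (qx q) + c * \sum_i `|X i t - qx q i| < z].
have mA z q : measurable (A z q).
  have mh : measurable_fun setT (fun t => v (qx q) + c * \sum_i `|X i t - qx q i|).
    apply: measurable_funD => //; apply: measurable_funM => //.
    apply: measurable_sum => i; apply: measurableT_comp;
        first exact: normr_measurable.
    exact: measurable_funB.
  by have := mh measurableT _ (measurable_itv `]-oo, z[); rewrite setTI set_itvE.
move=> mD; apply: (measurability _ (RGenInftyO.measurableE R)) => //.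
move=> _ [_ [z ->] <-]; rewrite setTI.
rewrite [X in measurable X](_ : _ = \bigcup_q A z q).
  exact: countable_bigcupT_measurable.
apply/seteqP; split=> t /=; rewrite in_itv /=.
(* With this [e], twice [c] times the l^1 distance to [q] stays below [z - v]: one share pays for
   replacing [v] by its value at [q], the other for the distance term. *)
- move=> vz; pose e : R := (z - v (X ^~ t)) / (2 * c * (#|I|%:R + 1)).
  have I0 : 0 < #|I|%:R + 1 :> R by rewrite ltr_wpDl.
  have e0 : 0 < e by rewrite divr_gt0// ?subr_gt0// !mulr_gt0.
  have /choice[q hq] : forall i, exists r : rat, `|X i t - ratr r| < e.
    move=> i; have /rat_in_itvoo[r] : X i t - e < X i t + e by lra.
    by rewrite in_itv/= => /andP[h1 h2]; exists r; rewrite ltr_norml; lra.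
  exists (finfun q) => //; rewrite /A /=.
  have hs : \sum_i `|X i t - qx (finfun q) i| <= #|I|%:R * e.
    rewrite mulr_natl -sumr_const; apply: ler_sum => i _.
    by rewrite /qx ffunE ltW.
  have := vc (qx (finfun q)) (X ^~ t).
  rewrite (eq_bigr (fun i => `|X i t - qx (finfun q) i|)); last by move=> i _;
      rewrite distrC.
  have : 2 * (c * (#|I|%:R * e)) < z - v (X ^~ t).
    have -> : z - v (X ^~ t) = 2 * c * (#|I|%:R + 1) * e.
      by rewrite /e; field; rewrite !gt_eqF.
    by rewrite -!mulrA ltr_pM2l// ltr_pM2l// mulrDl mul1r ltrDl.
  have := ler_wpM2l (ltW c0) hs; lra.
- by move=> [q _]; rewrite /A /= => h; apply: le_lt_trans h; exact: vc.
Qed.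

End LipschitzMeasurable.

Section ApproximationGap.
Context (R : realType) (I : finType) (d : measure_display).
Context (T : measurableType d) (P : probability T R) (Z Y : I -> T -> R).
Hypothesis mZ : forall i, measurable_fun setT (Z i).
Hypothesis mY : forall i, measurable_fun setT (Y i).
Hypothesis indZ : independent_funs P Z.
Hypothesis indY : independent_funs P Y.
Context (m3 : R).
Hypothesis iZ : forall i, P.-integrable setT (EFin \o (fun t => `|Z i t| ^+ 3)).
Hypothesis iY : forall i, P.-integrable setT (EFin \o (fun t => `|Y i t| ^+ 3)).
Hypothesis hm3 : forall i,
  \int[P]_t (`|Z i t| ^+ 3) + \int[P]_t (`|Y i t| ^+ 3) <= m3.
Hypothesis e1 : forall i, \int[P]_t Z i t = \int[P]_t Y i t.
Hypothesis e2 : forall i, \int[P]_t (Z i t ^+ 2) = \int[P]_t (Y i t ^+ 2).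
Hypothesis Z2 : forall i, \int[P]_t (Z i t ^+ 2) <= 1.

Lemma lipschitz_of_deriv (g g1 : R -> R) (K : R) : has_deriv g g1 ->
  (forall x, `|g1 x| <= K) -> forall x y, `|g x - g y| <= K * `|x - y|.
Proof.
move=> dg gK x y.
have := @MVT_abs _ _ _ (x - y) K (has_deriv_comp dg (has_deriv_affine y 1)).
by rewrite mulr0 addr0 mul1r [y + (x - y)]addrC subrK; apply => z _; rewrite mulr1.
Qed.

Lemma Rintegral_abs_sum (X : I -> T -> R) :
  (forall i, measurable_fun setT (X i)) ->
  (forall i, P.-integrable setT (EFin \o (fun t => `|X i t| ^+ 3))) ->
  (forall i, \int[P]_t (X i t ^+ 2) <= 1) ->
  P.-integrable setT (EFin \o (fun t => \sum_i `|X i t|)) /\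
  \int[P]_t (\sum_i `|X i t|) <= #|I|%:R.
Proof.
move=> mX iX X2.
have ia i : P.-integrable setT (fun t => (`|X i t|)%:E).
  by have [h _] := integrable_powers (mX i) (iX i); exact: integrable_norm.
have eE : EFin \o (fun t => \sum_i `|X i t|) = (fun t => \sum_i (`|X i t|)%:E)%E.
  by apply/funext => t /=; rewrite sumEFin.
split; first by rewrite eE; exact: integrable_sum.
have -> : \int[P]_t (\sum_i `|X i t|) = \sum_i \int[P]_t `|X i t|.
  rewrite /Rintegral.
  under eq_integral do rewrite -sumEFin.
  rewrite integral_sum// sum_fine// => i _; exact: integrable_fin_num.
rewrite -sum1_card natr_sum; apply: ler_sum => i _.
have [i1 i2] := integrable_powers (mX i) (iX i).
have ic := finite_measure_integrable_cst P 1 measurableT.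
have is2 := integrableD measurableT ic i2.
have is3 := integrableZl measurableT 2^-1 is2.
(* First absolute moments are bounded through [|x| <= (1 + x^2) / 2]. *)
apply: (@le_trans _ _ (\int[P]_t (2^-1 * (1 + X i t ^+ 2)))).
  apply: (le_Rintegral measurableT (ia i) is3) => t _.
  have : 0 <= (`|X i t| - 1) ^+ 2 by exact: sqr_ge0.
  by rewrite -(real_normK (num_real (X i t))) sqrrB expr1n mulr1 /=; lra.
rewrite RintegralZl// RintegralD// Rintegral_cst//.
have -> : fine (P setT) = 1 by rewrite probability_setT.
by have := X2 i; lra.
Qed.

(** Triangle inequality through the smooth [F]: the approximation error is paid once for [Z] and
    once for [Y], with the l^1 norm of the entries replaced by its mean, at most [#|I|]; the middle
    term is the Lindeberg bound. *)
Lemma approximation_gap (V : (I -> R) -> \bar R) (err kap a b K : R)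
    (g g1 g2 g3 : R -> R) :
  0 <= kap -> 0 <= a -> 1 <= b ->
  smoothly_approximable V err kap a b ->
  has_deriv g g1 -> has_deriv g1 g2 -> has_deriv g2 g3 ->
  (forall x, [/\ `|g x| <= K, `|g1 x| <= K, `|g2 x| <= K & `|g3 x| <= K]) ->
  coordinatewise_measurable (fun x => g (fine (V x))) /\
  `| \int[P]_t g (fine (V (Z ^~ t))) - \int[P]_t g (fine (V (Y ^~ t))) | <=
  2 * (K * (err + kap * #|I|%:R)) +
  #|I|%:R * (5 * K * ((smooth_cst R * a) ^+ 3 * b ^+ 2) * m3).
Proof.
move=> kap0 a0 b1 [v [F [hV hF hL hS hM]]] dg dg1 dg2 gK.
have K0 : 0 <= K by have [h _ _ _] := gK 0; apply: le_trans h.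
have -> : (fun x => g (fine (V x))) = (fun x => g (v x)).
  by apply/funext => x; rewrite hV.
under eq_Rintegral do rewrite hV /=.
under [X in _ - X]eq_Rintegral do rewrite hV /=.
have mg : measurable_fun setT g.
  by apply: continuous_measurable_fun; exact: has_deriv_continuous dg.
have mv : coordinatewise_measurable (fun x => g (v x)).
  by move=> d' T' X mX; apply: measurableT_comp => //;
      exact: lipschitz_measurable hL _ _ _ mX.
split=> //.
have mF : coordinatewise_measurable (fun x => g (F x)).
  by move=> d' T' X mX; apply: measurableT_comp => //; exact: hM.
have gb x : `|g x| <= K by have [] := gK x.
pose B := K * (smooth_cst R * a) + 2 * K * ((smooth_cst R * a) ^+ 2 * b).
pose M := 5 * K * ((smooth_cst R * a) ^+ 3 * b ^+ 2).
have C0 : 0 <= smooth_cst R * a by rewrite mulr_ge0// /smooth_cst; lra.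
have sF : smooth_coordinates (fun x => g (F x)) B M.
  move=> x k; have [f1 [f2 [f3 J]]] := hS x k.
  have gK' y : [/\ `|g1 y| <= K, `|g2 y| <= K & `|g3 y| <= K].
    by have [] := gK y.
  have [k1 [k2 [k3 [d1 d2 d3 bb]]]] := smooth_jet_comp C0 b1 dg dg1 dg2 gK' J.
  exists k1, k2, k3; split=> // s; have [h1 h2 h3] := bb s.
  have p1 : 0 <= K * (smooth_cst R * a) by exact: mulr_ge0.
  have p2 : 0 <= 2 * K * ((smooth_cst R * a) ^+ 2 * b).
    by rewrite !mulr_ge0// ?exprn_ge0// (le_trans _ b1).
  by split=> //; rewrite /B; lra.
have gap := lindeberg_decoupled mZ mY indZ indY mF (fun x => gb _) sF iZ iY hm3 e1 e2.
have appr (X : I -> T -> R) : (forall i, measurable_fun setT (X i)) ->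
  (forall i, P.-integrable setT (EFin \o (fun t => `|X i t| ^+ 3))) ->
  (forall i, \int[P]_t (X i t ^+ 2) <= 1) ->
  `|\int[P]_t g (v (X ^~ t)) - \int[P]_t g (F (X ^~ t))| <= K * (err + kap * #|I|%:R).
  move=> mX iX X2.
  have [ix ix1] := Rintegral_abs_sum mX iX X2.
  have iv : P.-integrable setT (EFin \o (fun t => g (v (X ^~ t)))).
    by apply: (@integrable_bounded _ _ _ _ _ K) => //; exact: mv.
  have iF : P.-integrable setT (EFin \o (fun t => g (F (X ^~ t)))).
    by apply: (@integrable_bounded _ _ _ _ _ K) => //; exact: mF.
  have ivF := integrableB measurableT iv iF.
  rewrite -RintegralB//; apply: le_trans (le_normr_Rintegral measurableT ivF) _.
  have ik := integrableZl measurableT kap ix.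
  have ie := finite_measure_integrable_cst P err measurableT.
  have iek := integrableD measurableT ie ik.
  have iK := integrableZl measurableT K iek.
  apply: (@le_trans _ _ (\int[P]_t (K * (err + kap * \sum_i `|X i t|)))).
    apply: le_Rintegral => //; first exact: integrable_norm.
    move=> t _; have := lipschitz_of_deriv dg (fun x => let: And4 _ h _ _ :=
        gK x in h) (v (X ^~ t)) (F (X ^~ t)).
    by move/le_trans; apply; rewrite ler_wpM2l.
  rewrite RintegralZl// RintegralD// RintegralZl// Rintegral_cst//.
  have -> : fine (P setT) = 1 by rewrite probability_setT.
  by rewrite mulr1 ler_wpM2l// lerD2l ler_wpM2l.
have hZ := appr Z mZ iZ Z2.
have hY : `|\int[P]_t g (v (Y ^~ t)) - \int[P]_t g (F (Y ^~ t))| <= K * (err +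
    kap * #|I|%:R).
  by apply: appr => // i; rewrite -e2.
move: hZ hY gap; rewrite -/M.
by rewrite !ler_norml => /andP[? ?] /andP[? ?] /andP[? ?]; apply/andP; split; lra.
Qed.

End ApproximationGap.

(** * Smooth step and choice of parameters *)

Section SmoothStep.
Context (R : realType).
Implicit Types (x y : R).

(** A quadratic remainder suffices for differentiability, so the kink of a truncated square needs no
    one-sided limits. *)
Lemma is_derive_quadratic (f : R -> R) (x l C : R) :
  (forall y, `|f y - f x - l * (y - x)| <= C * (y - x) ^+ 2) ->
  is_derive x 1 f l.
Proof.
move=> H.
have cv : (fun h => h^-1 *: ((f \o shift x) (h *: (1:R)) - f x)) @ 0^' --> l.
  apply/cvgrPdist_le => e e0; near=> h.
  have h0 : h != 0 by near: h; exact: nbhs_dnbhs_neq.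
  have hn : 0 < `|h| by rewrite normr_gt0.
  have := H (h + x); rewrite addrK => Hh.
  rewrite distrC /= /GRing.scale /= mulr1 -(ler_pM2l hn) -normrM.
  have -> : h * (h^-1 * (f (h + x) - f x) - l) = f (h + x) - f x - l * h by field.
  apply: (le_trans Hh).
  rewrite -(real_normK (num_real h)) expr2 mulrCA ler_wpM2l//.
  have : `|h| <= e / (`|C| + 1).
    near: h; apply: dnbhs0_le; rewrite divr_gt0// ltr_wpDl//.
  rewrite ler_pdivlMr ?ltr_wpDl// => h1.
  by have := ler_wpM2r (ltW hn) (ler_norm C); lra.
split; first by apply/cvg_ex; exists l.
exact: cvg_lim cv.
Unshelve. all: by end_near. Qed.

Definition trunc_power (k : nat) x : R := Num.max 0 x ^+ k.
Local Notation t := trunc_power.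

Lemma trunc_powerS k x : t k.+2 x = x * t k.+1 x.
Proof.
rewrite /t exprS; case: (leP 0 x) => [//|x0].
by rewrite expr0n /= !mulr0.
Qed.

Lemma has_deriv_trunc_power2 : has_deriv (t 2) (fun x => 2 * t 1 x).
Proof.
move=> x; apply: (@is_derive_quadratic _ _ _ 1) => y; rewrite mul1r /t expr1.
case: (leP 0 x) => x0; case: (leP 0 y) => y0; rewrite ler_norml.
- by apply/andP; split; have := sqr_ge0 (y - x); nra.
- by apply/andP; split; nra.
- by apply/andP; split; nra.
- by apply/andP; split; have := sqr_ge0 (y - x); nra.
Qed.

Lemma has_deriv_trunc_powerS k c : has_deriv (t k.+1) (fun x => c * t k x) ->
  (0 < k)%N -> has_deriv (t k.+2) (fun x => (c + 1) * t k.+1 x).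
Proof.
case: k => // k dt _.
have -> : t k.+3 = (fun x => (0 + 1 * x) * t k.+2 x).
  by apply/funext => x; rewrite trunc_powerS add0r mul1r.
apply: has_deriv_eq (has_derivM (has_deriv_affine 0 1) dt) => x.
by rewrite (trunc_powerS k); ring.
Qed.

Lemma has_deriv_trunc_power3 : has_deriv (t 3) (fun x => 3 * t 2 x).
Proof.
apply: has_deriv_eq (has_deriv_trunc_powerS has_deriv_trunc_power2 isT) => x; ring.
Qed.

Lemma has_deriv_trunc_power4 : has_deriv (t 4) (fun x => 4 * t 3 x).
Proof.
apply: has_deriv_eq (has_deriv_trunc_powerS has_deriv_trunc_power3 isT) => x; ring.
Qed.

Lemma trunc_power_ge0 k x : 0 <= t k x.
Proof. by rewrite exprn_ge0// le_max lexx. Qed.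

Lemma trunc_power_le1 k x : x <= 1 -> t k x <= 1.
Proof. by move=> x1; rewrite exprn_ile1 ?le_max ?lexx// ge_max ler01. Qed.

(** The truncated fourth power has three continuous derivatives. Near [x = 1] the inner expression
    vanishes, and the outer fourth power flattens the junction there. *)
Definition smooth_step x : R := 1 - t 4 (1 - t 4 x).

Lemma smooth_step0 x : x <= 0 -> smooth_step x = 0.
Proof.
move=> x0; rewrite /smooth_step /t (max_l x0) expr0n /= subr0 max_r ?ler01//.
by rewrite expr1n subrr.
Qed.

Lemma smooth_step1 x : 1 <= x -> smooth_step x = 1.
Proof.
move=> x1; rewrite /smooth_step /t (max_r (le_trans ler01 x1)) max_l.
  by rewrite expr0n /= subr0.
by rewrite subr_le0 exprn_ege1.
Qed.

Lemma smooth_step_itv x : 0 <= smooth_step x <= 1.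
Proof.
rewrite /smooth_step subr_ge0 gerBl trunc_power_ge0 andbT.
by rewrite trunc_power_le1// gerBl trunc_power_ge0.
Qed.

(** 3360 = 1536 + 1728 + 96 is the sum of the coefficients of the third derivative, each product of
    truncated powers being at most 1. *)
Lemma smooth_step_jet : exists h1 h2 h3,
  [/\ has_deriv smooth_step h1, has_deriv h1 h2, has_deriv h2 h3 &
   forall x, [/\ `|smooth_step x| <= 3360, `|h1 x| <= 3360, `|h2 x| <= 3360
     & `|h3 x| <= 3360]].
Proof.
pose u x := 1 - t 4 x.
have du : has_deriv u (fun x => - 4 * t 3 x).
  have := has_derivD (has_deriv_affine 1 0) (has_derivN has_deriv_trunc_power4).
  have -> : (fun x => 1 + 0 * x + - t 4 x) = u.
    by apply/funext => x; rewrite mul0r addr0.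
  by apply: has_deriv_eq => x; ring.
have d4 := has_deriv_comp has_deriv_trunc_power4 du.
have d3 := has_deriv_comp has_deriv_trunc_power3 du.
have d2 := has_deriv_comp has_deriv_trunc_power2 du.
have [e2 e3] := (has_deriv_trunc_power2, has_deriv_trunc_power3).
exists (fun x => 16 * (t 3 (u x) * t 3 x)).
exists (fun x => - 192 * (t 2 (u x) * (t 3 x * t 3 x)) + 48 * (t 3 (u x) * t 2 x)).
exists (fun x => 1536 * (t 1 (u x) * (t 3 x * (t 3 x * t 3 x)))
  - 1728 * (t 2 (u x) * (t 3 x * t 2 x)) + 96 * (t 3 (u x) * t 1 x)).
split.
- have := has_derivD (has_deriv_affine 1 0) (has_derivN d4).
  have -> : (fun x => 1 + 0 * x + - t 4 (u x)) = smooth_step.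
    by apply/funext => x; rewrite mul0r addr0.
  by apply: has_deriv_eq => x; ring.
- apply: has_deriv_eq (has_derivZ 16 (has_derivM d3 e3)) => x; ring.
- apply: has_deriv_eq (has_derivD (has_derivZ (- 192) (has_derivM d2 (has_derivM
      e3 e3)))
    (has_derivZ 48 (has_derivM d3 e2))) => x; ring.
move=> x.
have u1 : u x <= 1 by rewrite /u gerBl trunc_power_ge0.
have tu k : 0 <= t k (u x) <= 1.
  by rewrite trunc_power_ge0 trunc_power_le1.
(* Either x <= 1, or the truncated power of [u x] vanishes. *)
have B k y : (0 <= y) -> (1 < x \/ y <= 1) -> 0 <= t k.+1 (u x) * y <= 1.
  move=> y0 [x1|y1].
    have -> : t k.+1 (u x) = 0.
      rewrite /t max_l ?expr0n// /u subr_le0 /t exprn_ege1// le_max.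
      by rewrite (ltW x1) orbT.
    by rewrite mul0r lexx ler01.
  have /andP[t0 t1] := tu k.+1.
  by rewrite mulr_ge0//= mulr_ile1.
have tx k : 1 < x \/ t k x <= 1.
  have [x1|] := leP x 1; last by left.
  by right; exact: trunc_power_le1.
have txx k l : 1 < x \/ t k x * t l x <= 1.
  have [|h] := tx k; first by left.
  have [|h'] := tx l; first by left.
  by right; rewrite mulr_ile1 ?trunc_power_ge0.
have txxx : 1 < x \/ t 3 x * (t 3 x * t 3 x) <= 1.
  have [|h] := tx 3; first by left.
  have [|h'] := txx 3 3; first by left.
  right; apply: mulr_ile1; rewrite ?trunc_power_ge0//.
  by apply: mulr_ge0; exact: trunc_power_ge0.
have p k := trunc_power_ge0 k x.
have /andP[? ?] := B 2 (t 3 x) (p _) (tx _).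
have /andP[? ?] := B 1 (t 3 x * t 3 x) (mulr_ge0 (p _) (p _)) (txx _ _).
have /andP[? ?] := B 2 (t 2 x) (p _) (tx _).
have /andP[? ?] := B 0 (t 3 x * (t 3 x * t 3 x)) (mulr_ge0 (p _) (mulr_ge0 (p _)
    (p _))) txxx.
have /andP[? ?] := B 1 (t 3 x * t 2 x) (mulr_ge0 (p _) (p _)) (txx _ _).
have /andP[? ?] := B 2 (t 1 x) (p _) (tx _).
have /andP[? ?] := smooth_step_itv x.
by split; rewrite ler_norml; apply/andP; split; lra.
Qed.

(** The step is stretched over an interval of length [2 * eps], so the k-th derivative gains the
    k-th power of 1/(2 eps). For [k <= 3] it is at most 1 when [1 <= eps] and at most [eps ^- 3]
    otherwise. *)
Lemma smooth_step_scaled : exists2 c : R, 0 < c &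
  forall z eps : R, 0 < eps ->
  exists g g1 g2 g3 : R -> R,
  [/\ has_deriv g g1 /\ has_deriv g1 g2 /\ has_deriv g2 g3,
   forall x, [/\ `|g x| <= c * Num.max 1 (eps ^- 3),
     `|g1 x| <= c * Num.max 1 (eps ^- 3),
     `|g2 x| <= c * Num.max 1 (eps ^- 3)
     & `|g3 x| <= c * Num.max 1 (eps ^- 3)],
   forall x, 0 <= g x <= 1, forall x, x <= z + eps -> g x = 0 &
   forall x, z + 3 * eps <= x -> g x = 1].
Proof.
have [h1 [h2 [h3 [d1 d2 d3]]]] := smooth_step_jet.
have : 0 < 3360 :> R by lra.
move: (3360 : R) => c c0 b; exists c => // z eps e0.
pose s : R := (2 * eps)^-1.
have s0 : 0 < s by rewrite invr_gt0 mulr_gt0.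
pose aff x := - s * (z + eps) + s * x.
have daff : has_deriv aff (fun=> s) by exact: has_deriv_affine.
have affE x : aff x = (x - (z + eps)) / (2 * eps).
  by rewrite /aff /s; field; rewrite gt_eqF.
have [D1 D2 D3] : [/\ has_deriv (fun x => smooth_step (aff x)) (fun x =>
    s * h1 (aff x)),
    has_deriv (fun x => s * h1 (aff x)) (fun x => s ^+ 2 * h2 (aff x)) &
    has_deriv (fun x => s ^+ 2 * h2 (aff x)) (fun x => s ^+ 3 * h3 (aff x))].
  split.
  - by apply: has_deriv_eq (has_deriv_comp d1 daff) => x; ring.
  - by apply: has_deriv_eq (has_derivZ s (has_deriv_comp d2 daff)) => x; ring.
  - by apply: has_deriv_eq (has_derivZ (s ^+ 2) (has_deriv_comp d3 daff)) => x; ring.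
set M := Num.max 1 (eps ^- 3).
have M1 : 1 <= M by rewrite le_max lexx.
have sM k : (k <= 3)%N -> s ^+ k <= M.
  move=> k3; have se : s <= eps^-1 by rewrite lef_pV2 ?posrE ?mulr_gt0//; lra.
  have [e1|e1] := leP 1 eps.
    apply: (le_trans _ M1); rewrite exprn_ile1 ?(ltW s0)//.
    by rewrite (le_trans se)// invf_le1.
  apply: (@le_trans _ _ (eps^-1 ^+ 3)); last by rewrite exprVn le_max lexx orbT.
  apply: (@le_trans _ _ (eps^-1 ^+ k)).
    by rewrite lerXn2r// nnegrE ?(ltW s0)// invr_ge0 ltW.
  by apply: ler_weXn2l => //; rewrite invf_ge1// ltW.
have BB (r : R) k : (k <= 3)%N -> `|r| <= c -> `|s ^+ k * r| <= c * M.
  move=> k3 hr; rewrite normrM mulrC; apply: ler_pM => //.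
  by rewrite ger0_norm ?sM// exprn_ge0// ltW.
exists (fun x => smooth_step (aff x)), (fun x => s * h1 (aff x)).
exists (fun x => s ^+ 2 * h2 (aff x)), (fun x => s ^+ 3 * h3 (aff x)).
split=> // [x|x|x xz|x xz].
- have [b0 b1 b2 b3] := b (aff x).
  split; [|exact: (@BB _ 1%N)|exact: BB|exact: BB].
  by have := @BB _ 0%N isT b0; rewrite expr0 mul1r.
- exact: smooth_step_itv.
- apply: smooth_step0; rewrite affE pmulr_lle0 ?subr_le0//.
- by apply: smooth_step1; rewrite affE ler_pdivlMr ?mulr_gt0//; lra.
Qed.

End SmoothStep.

(** * Balancing the errors *)

Section Arithmetic.
Context (R : realType).

(** 16 / tau is twice the sum of 6 / tau from the soft max-min and 2 / tau from the mesh; the last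
    term is the Lindeberg cost. The 4 covers the oscillation of [Q] and the case [b < 1]. The
    absolute value keeps the constant positive for every [M0]. *)
Definition gap_cst (tau M0 : R) : R :=
  4 + 16 / tau + 5 * smooth_cst R ^+ 3 * `|M0| / tau ^+ 7.

Lemma gap_cst_ge4 (tau M0 : R) : 0 < tau -> 4 <= gap_cst tau M0.
Proof.
move=> t0; have h1 : 0 <= 16 / tau by rewrite divr_ge0// ltW.
have C30 : 0 <= smooth_cst R ^+ 3 by rewrite exprn_ge0// /smooth_cst; lra.
have h2 : 0 <= 5 * smooth_cst R ^+ 3 * `|M0| / tau ^+ 7.
  apply: mulr_ge0; last by rewrite invr_ge0 exprn_ge0// ltW.
  by apply: mulr_ge0 => //; exact: mulr_ge0.
by rewrite /gap_cst; lra.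
Qed.

(* [n = nu^6] and [ln (L / delta) = l^3], and the inverse temperature
   [nu^7 l / L^2] balances the soft-max error against the Lindeberg error. *)
Lemma gap_arith (tau M0 K o L delta l nu s m n b : R) :
  m = s ^+ 2 -> n = nu ^+ 6 -> b = nu ^+ 7 * l / L ^+ 2 ->
  0 < tau < 1 -> 0 <= M0 -> 0 <= o -> 0 < K -> 1 <= nu -> 0 < s -> 2 <= L ->
      2^-1 <= l ->
  0 < delta <= n^-1 -> tau <= m / n <= tau^-1 ->
  2 * (K * (o + b^-1 * (3 * (m + n) * l ^+ 3) + m^-1 * s^-1 * (delta * L) * (m * n)))
  + m * n * (5 * K * ((smooth_cst R * (m^-1 * s^-1 * L ^+ 2)) ^+ 3 * b ^+ 2) * M0)
  <= gap_cst tau M0 * K * (o + L ^+ 2 * l ^+ 2 / nu).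
Proof.
move=> em en eb /andP[t0 t1] M00 o0 K0 nu1 s0 L2 l2 /andP[d0 dn] /andP[mn1 mn2].
have nu0 : 0 < nu by lra.
have L0 : 0 < L by lra.
have l0 : 0 < l by lra.
have C0 : 0 < smooth_cst R by rewrite /smooth_cst; lra.
have C30 : 0 <= smooth_cst R ^+ 3 by rewrite exprn_ge0// ltW.
set E := L ^+ 2 * l ^+ 2 / nu.
have E0 : 0 <= E by rewrite !mulr_ge0 ?invr_ge0 ?exprn_ge0// ltW.
have n0 : 0 < n by rewrite en exprn_gt0.
have m0 : 0 < m by rewrite em exprn_gt0.
rewrite ler_pdivlMr// in mn1; rewrite ler_pdivrMr// in mn2.
have nz : [&& nu != 0, L != 0, l != 0 & s != 0] by rewrite !gt_eqF.
case/and4P : nz => nu_n L_n l_n s_n.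
have ti1 : 1 <= tau^-1 by rewrite invf_ge1// ltW.
have T1 : b^-1 * (3 * (m + n) * l ^+ 3) <= 6 / tau * E.
  have -> : b^-1 * (3 * (m + n) * l ^+ 3) = 3 * ((m + n) / n) * E.
    by rewrite eb en /E; field; rewrite nu_n L_n l_n.
  rewrite ler_wpM2r// (_ : 6 / tau = 3 * (2 / tau)); last by field; rewrite gt_eqF.
  rewrite ler_wpM2l// ler_pdivrMr//.
  by have := ler_wpM2r (ltW n0) ti1; lra.
(* From [m >= tau n >= tau^2 n]; giving up a factor [tau] avoids its square root. *)
have stau : tau * nu ^+ 3 <= s.
  rewrite -(@ler_pXn2r _ 2) ?nnegrE ?(ltW s0)//; last by rewrite mulr_ge0
      ?exprn_ge0 ?ltW.
  rewrite exprMn -exprM; rewrite -em; apply: (le_trans _ mn1).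
  rewrite en.
  by rewrite ler_wpM2r ?exprn_ge0 ?(ltW nu0)// expr2 ler_piMl// ltW.
(* This is where [delta <= n^-1] is used: the l^1 norm of the entries is of order [m n], and the
   mesh must offset it. *)
have T2 : m^-1 * s^-1 * (delta * L) * (m * n) <= 2 / tau * E.
  have -> : m^-1 * s^-1 * (delta * L) * (m * n) = (delta * n) * (L / s).
    by rewrite em en; field; rewrite s_n.
  have dn1 : delta * n <= 1 by rewrite -ler_pdivlMr// div1r.
  apply: (@le_trans _ _ (1 * (L / s))).
    by rewrite ler_wpM2r// divr_ge0// ltW.
  rewrite mul1r ler_pdivrMr//.
  have nu3 : nu <= nu ^+ 3 by exact: le_cube.
  have h : tau * nu <= s by apply: (le_trans _ stau); rewrite ler_wpM2l// ltW.
  apply: (@le_trans _ _ (2 / tau * E * (tau * nu))); last first.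
    by apply: ler_wpM2l => //; apply: mulr_ge0 => //; rewrite divr_ge0// ltW.
  have -> : 2 / tau * E * (tau * nu) = L * (2 * (L * l ^+ 2)).
    by rewrite /E; field; rewrite nu_n gt_eqF.
  rewrite ler_peMr ?(ltW L0)//.
  have : (2^-1) ^+ 2 <= l ^+ 2 by rewrite lerXn2r// nnegrE ltW.
  rewrite exprVn => l22; have := ler_pM (ler0n _ 2) _ L2 l22.
  by rewrite invr_ge0 exprn_ge0// => /(_ isT); lra.
(* All powers collect into [E * (nu ^+ 21 / s ^+ 7)], and [stau] turns the last factor into
   [tau ^- 7]. *)
have T3 : m * n * (5 * K * ((smooth_cst R * (m^-1 * s^-1 * L ^+ 2)) ^+ 3 * b ^+
    2) * M0)
   <= 5 * smooth_cst R ^+ 3 * `|M0| / tau ^+ 7 * K * E.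
  have -> : m * n * (5 * K * ((smooth_cst R * (m^-1 * s^-1 * L ^+ 2)) ^+ 3 * b
      ^+ 2) * M0)
     = (5 * smooth_cst R ^+ 3 * M0 * K * E) * (nu ^+ 21 / s ^+ 7).
    by rewrite eb em en /E; field; rewrite s_n L_n nu_n.
  have -> : 5 * smooth_cst R ^+ 3 * `|M0| / tau ^+ 7 * K * E =
    (5 * smooth_cst R ^+ 3 * M0 * K * E) * (tau ^- 7).
    by rewrite ger0_norm//; ring.
  apply: ler_wpM2l.
    apply: mulr_ge0 => //; apply: mulr_ge0; last exact: ltW.
    by apply: mulr_ge0 => //; apply: mulr_ge0.
  rewrite ler_pdivrMr ?exprn_gt0// mulrC ler_pdivlMr ?exprn_gt0//.
  rewrite (_ : nu ^+ 21 * tau ^+ 7 = (tau * nu ^+ 3) ^+ 7); last by ring.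
  by rewrite lerXn2r// nnegrE ?mulr_ge0 ?exprn_ge0// ltW.
set X1 := b^-1 * _ in T1 *; set X2 := m^-1 * s^-1 * _ * _ in T2 *.
set X3 := m * n * _ in T3 *; set c := 5 * smooth_cst R ^+ 3 * `|M0| / tau ^+ 7
    in T3 *.
have c0 : 0 <= c.
  rewrite /c; apply: mulr_ge0; last by rewrite invr_ge0 exprn_ge0// ltW.
  by apply: mulr_ge0 => //; apply: mulr_ge0.
have G : gap_cst tau M0 = 4 + 16 / tau + c by [].
rewrite G.
have it0 : 0 < tau^-1 by rewrite invr_gt0.
have T12 : K * (o + X1 + X2) <= K * (o + 8 * (tau^-1 * E)) by rewrite ler_wpM2l
    ?(ltW K0)//; lra.
have Ko : 0 <= K * o by apply: mulr_ge0 => //; exact: ltW.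
have KE : 0 <= K * E by apply: mulr_ge0 => //; exact: ltW.
have Kot : 0 <= K * o * tau^-1 by apply: mulr_ge0 => //; exact: ltW.
have Koc : 0 <= K * o * c by exact: mulr_ge0.
move: (tau^-1) T12 Kot => it T12 Kot; move: X1 X2 X3 T12 T3 {T1 T2} =>
    X1 X2 X3 T12 T3.
move: c E Koc KE T12 T3 {c0 E0 G} => c E *; lra.
Qed.

Lemma ln2_ge_half : 2^-1 <= ln 2 :> R.
Proof.
have := @le_ln1Dx R (- 2^-1); rewrite (_ : 1 + - 2^-1 = 2^-1); last by lra.
by rewrite lnV ?posrE// => /(_ _); rewrite lerN2; apply; lra.
Qed.

End Arithmetic.

(** * The comparison at the optimal temperature *)

Section Moments.
Context (d : measure_display) (T : measurableType d) (R : realType).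
Context (P : probability T R) (m n : nat).
Implicit Types A B : 'I_m -> 'I_n -> {RV P >-> R}.

Lemma ae_zero_integral (Z : T -> R) (f : R -> R) : measurable_fun setT Z ->
  {ae P, forall t, Z t = 0} -> measurable_fun setT f -> f 0 = 0 ->
  (\int[P]_t (f (Z t))%:E = 0)%E.
Proof.
move=> mZ Z0 mf f0.
have -> : (0 = \int[P]_t (cst 0 t) :> \bar R)%E by rewrite integral0.
apply: ae_eq_integral => //.
- by apply/measurable_EFinP; exact: measurableT_comp.
- by apply: filterS Z0 => t /= -> _; rewrite f0.
Qed.

Lemma entry_moments A (S : {set 'I_m * 'I_n}) (ij : 'I_m * 'I_n) :
  standardized_off S A ->
  (ij \notin S -> 'E_P[(fun t => (`|A ij.1 ij.2 t| ^+ 3)%R)] < +oo)%E ->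
  [/\ P.-integrable setT (EFin \o (fun t => `|A ij.1 ij.2 t| ^+ 3)),
      \int[P]_t (A ij.1 ij.2 t) = 0,
      \int[P]_t (A ij.1 ij.2 t ^+ 2) = (ij \notin S)%:R &
      ij \in S -> \int[P]_t (`|A ij.1 ij.2 t| ^+ 3) = 0].
Proof.
case: ij => i j /= [hS hN] h3.
have mA : measurable_fun setT (A i j) by [].
have m3 : measurable_fun setT (fun x : R => `|x| ^+ 3).
  by apply: measurable_funX; exact: normr_measurable.
have m2 : measurable_fun setT (fun x : R => x ^+ 2) by exact: exprn_measurable.
have mA3 : measurable_fun setT (EFin \o (fun t => `|A i j t| ^+ 3)).
  by apply/measurable_EFinP; apply: (measurableT_comp m3).
have I3 : (\int[P]_t `|(EFin \o (fun t => (`|A i j t| ^+ 3)%R)) t| =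
           \int[P]_t (`|A i j t| ^+ 3)%:E)%E.
  by apply: eq_integral => t _ /=; rewrite ger0_norm// exprn_ge0.
case: (boolP ((i, j) \in S)) => ijS.
- have Z0 := hS i j ijS.
  have e3 := ae_zero_integral mA Z0 m3.
  split.
  + apply/integrableP; split=> //; rewrite I3 e3 ?ltry// normr0 expr0n//.
  + rewrite /Rintegral (ae_zero_integral (f := id) mA Z0)//.
  + by rewrite /Rintegral (ae_zero_integral mA Z0 m2)// expr0n.
  + by move=> _; rewrite /Rintegral e3// normr0 expr0n.
- have := h3 ijS; rewrite unlock => h3'.
  have e1 := hN i j ijS 1%N isT; have e2 := hN i j ijS 2%N isT.
  rewrite unlock /= in e1 e2.
  split=> //.
  + by apply/integrableP; split=> //; rewrite I3.
  + rewrite /Rintegral; transitivity (fine (0%:E : \bar R)) => //; congr fine.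
    by rewrite -[RHS]e1; apply: eq_integral => t _; rewrite expr1.
  + by rewrite /Rintegral e2.
Qed.

Lemma third_moment_le A B (S : {set 'I_m * 'I_n}) (M0 : R) :
  max_third_moment S A B = M0%:E ->
  0 <= M0 /\ forall ij, ij \notin S ->
  ('E_P[(fun t => (`|A ij.1 ij.2 t| ^+ 3)%R)] + 'E_P[(fun t =>
      (`|B ij.1 ij.2 t| ^+ 3)%R)]
   <= M0%:E)%E.
Proof.
move=> h; split.
  rewrite -lee_fin -h /max_third_moment; exact: bigmax_ge_id.
move=> ij ijS; rewrite -h /max_third_moment.
apply: (le_bigmax_cond _ (fun ij => 'E_P[(fun t => (`|A ij.1 ij.2 t| ^+ 3)%R)] +
   'E_P[(fun t => (`|B ij.1 ij.2 t| ^+ 3)%R)])%E ijS).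
Qed.

(** Entries indexed by [S] have all moments zero under both laws, so they satisfy the same matching
    conditions as the others and the exchange needs no case distinction. *)
Lemma paired_moments A B (S : {set 'I_m * 'I_n}) (M0 : R) :
  standardized_off S A -> standardized_off S B ->
  max_third_moment S A B = M0%:E ->
  forall ij : 'I_m * 'I_n,
  [/\ P.-integrable setT (EFin \o (fun t => `|A ij.1 ij.2 t| ^+ 3)) /\
      P.-integrable setT (EFin \o (fun t => `|B ij.1 ij.2 t| ^+ 3)),
      \int[P]_t (`|A ij.1 ij.2 t| ^+ 3) + \int[P]_t (`|B ij.1 ij.2 t| ^+ 3) <= M0,
      \int[P]_t (A ij.1 ij.2 t) = \int[P]_t (B ij.1 ij.2 t),
      \int[P]_t (A ij.1 ij.2 t ^+ 2) = \int[P]_t (B ij.1 ij.2 t ^+ 2) &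
      \int[P]_t (A ij.1 ij.2 t ^+ 2) <= 1].
Proof.
move=> sA sB hM ij; have [M00 hle] := third_moment_le hM.
have E0 (X : 'I_m -> 'I_n -> {RV P >-> R}) :
    (0 <= 'E_P[(fun t => (`|X ij.1 ij.2 t| ^+ 3)%R)])%E.
  by apply: expectation_ge0 => t; rewrite exprn_ge0.
have hA : ij \notin S -> ('E_P[(fun t => (`|A ij.1 ij.2 t| ^+ 3)%R)] < +oo)%E.
  move=> /hle h; apply: le_lt_trans (ltry M0); apply: le_trans h;
      rewrite leeDl//; exact: E0.
have hB : ij \notin S -> ('E_P[(fun t => (`|B ij.1 ij.2 t| ^+ 3)%R)] < +oo)%E.
  move=> /hle h; apply: le_lt_trans (ltry M0); apply: le_trans h;
      rewrite leeDr//; exact: E0.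
have [iA A1 A2 A3] := entry_moments sA hA.
have [iB B1 B2 B3] := entry_moments sB hB.
split=> //; [|by rewrite A1 B1|by rewrite A2 B2|by rewrite A2 lern1;
    case: (_ \notin _)].
case: (boolP (ij \in S)) => ijS; first by rewrite A3// B3// addr0.
have := hle ij ijS; rewrite unlock /Rintegral -lee_fin EFinD !fineK//.
  exact: integrable_fin_num.
exact: integrable_fin_num.
Qed.

End Moments.

Section RateBounds.
Context (R : realType) (m n : nat).
Implicit Types (Q : 'cV[R]_m -> 'cV[R]_n -> R).

Lemma osc_ge0 Q (L delta : R) : 0 <= L -> 0 <= delta -> (0 <= osc Q L delta)%E.
Proof.
move=> L0 d0; apply: ereal_sup_ubound; exists 0, 0, 0, 0.
have c0 k : cube L (0 : 'cV[R]_k) by move=> i; rewrite mxE oppr_le0 L0.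
split; [by split|by split| |by rewrite subrr normr0].
by rewrite !subrr ge_max !normr0 d0.
Qed.

(** The cube root of the logarithm makes the balancing inequality polynomial. Its lower bound
    follows from [ln 2 >= 1/2], which exceeds the cube of 1/2. *)
Lemma third_root_bound (L delta : R) : 2 <= L / delta ->
  let l := ln (L / delta) `^ 3^-1 in
  [/\ 2^-1 <= l, l ^+ 3 = ln (L / delta) & l ^+ 2 = ln (L / delta) `^ (2 / 3)].
Proof.
move=> y2; set y := L / delta in y2 *; move=> l.
have ly : 2^-1 <= ln y.
  by apply: (le_trans (@ln2_ge_half R)); rewrite ler_ln ?posrE//; lra.
have ly0 : 0 <= ln y by lra.
have l3 : l ^+ 3 = ln y.
  by rewrite -powR_mulrn ?powR_ge0// -powRrM mulVf// powRr1.
split=> //.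
  rewrite leNgt; apply/negP => lt.
  have : l ^+ 3 < (2^-1) ^+ 3.
    by rewrite ltrXn2r// ?powR_ge0// ltW.
  by rewrite l3; lra.
by rewrite -powR_mulrn ?powR_ge0// -powRrM mulrC.
Qed.

(** [L >= 2] and [l >= 1/2] bound every member of the infimum below by [n^(-1/6)]. Strict positivity
    turns the right-hand sides into [+oo] when [Kg g] is infinite. *)
Lemma rate_gt0 Q (L : R) : (0 < n)%N -> 2 <= L -> (0 < rate Q L)%E.
Proof.
move=> n0 L2; have nR : 1 <= n%:R :> R by rewrite ler1n.
have nu0 : 0 < n%:R `^ (1 / 6) :> R by rewrite powR_gt0//; lra.
apply: (@lt_le_trans _ _ ((n%:R `^ (1 / 6))^-1)%:E);
    first by rewrite lte_fin invr_gt0.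
apply: le_ereal_inf_tmp => _ [delta /andP[d0 dn] <-].
have d1 : delta <= 1 by apply: (le_trans dn); rewrite invf_le1//; lra.
have y2 : 2 <= L / delta by rewrite ler_pdivlMr//; lra.
have [l2 _ <-] := third_root_bound y2; set l := ln _ `^ _ in l2 *.
apply: (@le_trans _ _ (L ^+ 2 * l ^+ 2 / n%:R `^ (1 / 6))%:E).
  rewrite lee_fin ler_peMl ?invr_ge0 ?(ltW nu0)// -exprMn.
  rewrite exprn_ege1//; have := ler_pM (ler0n _ 2) _ L2 l2.
  by rewrite invr_ge0 ler0n => /(_ isT); lra.
by rewrite leeDr// osc_ge0//; lra.
Qed.

End RateBounds.

Section ValueGap.
Context (R : realType) (tau M0 : R) (m n : nat).
Hypotheses (tau01 : 0 < tau < 1) (m0 : (0 < m)%N) (n0 : (0 < n)%N).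
Hypothesis mn : tau <= m%:R / n%:R <= tau^-1.
Context (d : measure_display) (T : measurableType d) (P : probability T R).
Context (A0 B0 : 'I_m -> 'I_n -> {RV P >-> R}) (S : {set 'I_m * 'I_n}).
Hypotheses (indA : independent_entries A0) (indB : independent_entries B0).
Hypotheses (stA : standardized_off S A0) (stB : standardized_off S B0).
Hypothesis hM : max_third_moment S A0 B0 = M0%:E.
Context (Q : 'cV[R]_m -> 'cV[R]_n -> R).
Context (Lu Lw : R) (Su : set 'cV[R]_m) (Sw : set 'cV[R]_n).
Hypotheses (Lu1 : 1 <= Lu) (Lw1 : 1 <= Lw).
Hypotheses (SuL : Su `<=` cube Lu) (SwL : Sw `<=` cube Lw).
Hypotheses (Su0 : Su !=set0) (Sw0 : Sw !=set0).
Context (V : ('cV[R]_m -> 'cV[R]_n -> R) -> \bar R).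
Hypothesis hV : [\/ V = max_min Su Sw, V = min_max Su Sw | V = min_max_swap Su Sw].
Local Notation L := (Lu + Lw).
Local Notation VA := (fun t => V (Xn Q (scaled_mx A0 t))).
Local Notation VB := (fun t => V (Xn Q (scaled_mx B0 t))).
Local Notation entries A := (fun ij t => A ij.1 ij.2 t).
Local Notation Vx := (fun x => V (affine_payoff Q (@bilinear_coef R m n) x)).

Let nR : 1 <= n%:R :> R. Proof. by rewrite ler1n. Qed.

Let delta_le1 (delta : R) : 0 < delta <= n%:R^-1 -> 0 < delta <= 1.
Proof.
move=> /andP[-> dn] /=; apply: (le_trans dn); rewrite invf_le1//.
exact: lt_le_trans nR.
Qed.

Lemma value_measurable (delta o : R) : 0 < delta <= n%:R^-1 ->
  osc Q L delta = o%:E ->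
  coordinatewise_measurable (fun x => fine (Vx x)) /\ forall x, Vx x \is a fin_num.
Proof.
move=> hd ho.
(* Any temperature will do, here [b = 1], since the Lipschitz bound does not depend on it. *)
have [v [F [hv _ hL _ _]]] := optimal_value_approximable Lu1 Lw1 SuL SwL Su0 Sw0
  m0 (delta_le1 hd) ho ltr01 hV.
split=> [|x]; last by rewrite hv.
have -> : (fun x => fine (Vx x)) = v by apply/funext => x; rewrite hv.
exact: lipschitz_measurable hL.
Qed.

Context (g g1 g2 g3 : R -> R) (K : R).
Hypotheses (K0 : 0 < K) (dg : has_deriv g g1) (dg1 : has_deriv g1 g2).
Hypothesis dg2 : has_deriv g2 g3.
Hypothesis gK :
  forall x, [/\ `|g x| <= K, `|g1 x| <= K, `|g2 x| <= K & `|g3 x| <= K].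

Lemma value_gap_delta (delta o : R) : 0 < delta <= n%:R^-1 ->
  osc Q L delta = o%:E ->
  `|\int[P]_t g (fine (VA t)) - \int[P]_t g (fine (VB t))| <=
  gap_cst tau M0 * K * (o + L ^+ 2 * ln (L / delta) `^ (2 / 3) / n%:R `^ (1 / 6)).
Proof.
move=> hd ho.
have /andP[d0 d1] := delta_le1 hd.
have L2 : 2 <= L by move: Lu1 Lw1; lra.
have y2 : 2 <= L / delta by rewrite ler_pdivlMr//; lra.
have [l2 l3 <-] := third_root_bound y2.
set l := ln (L / delta) `^ 3^-1 in l2 l3 *.
set nu : R := n%:R `^ (1 / 6).
have nu6 : n%:R = nu ^+ 6.
  by rewrite -powR_mulrn ?powR_ge0// -powRrM div1r mulVf// powRr1.
have nu1 : 1 <= nu.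
  by rewrite /nu -[leLHS](powRr0 n%:R); apply: ler_powR => //; lra.
pose s : R := Num.sqrt m%:R.
have s0 : 0 < s by rewrite sqrtr_gt0 ltr0n.
have ms : m%:R = s ^+ 2 by rewrite sqr_sqrtr.
have o0 : 0 <= o by rewrite -lee_fin -ho osc_ge0//; lra.
have [M00 _] := third_moment_le hM.
have mom := paired_moments stA stB hM.
under eq_Rintegral do rewrite Xn_scaled_mx.
under [X in _ - X]eq_Rintegral do rewrite Xn_scaled_mx.
pose b := nu ^+ 7 * l / L ^+ 2.
have mA ij : measurable_fun setT (entries A0 ij) by [].
have mB ij : measurable_fun setT (entries B0 ij) by [].
set E := L ^+ 2 * l ^+ 2 / nu.
have E0 : 0 <= E by apply: divr_ge0; [apply: mulr_ge0; exact: sqr_ge0|lra].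
have [b1|b1] := leP 1 b.
- have b0 : 0 < b by exact: lt_le_trans b1.
  have apx := optimal_value_approximable Lu1 Lw1 SuL SwL Su0 Sw0
    m0 (delta_le1 hd) ho b0 hV.
  have a0 : 0 <= m%:R^-1 * (Num.sqrt m%:R)^-1 * L ^+ 2 :> R.
    by apply: mulr_ge0; [apply: mulr_ge0; rewrite invr_ge0 ?sqrtr_ge0|exact: sqr_ge0].
  have k0 : 0 <= m%:R^-1 * (Num.sqrt m%:R)^-1 * (delta * L) :> R.
    apply: mulr_ge0; first by apply: mulr_ge0; rewrite invr_ge0 ?sqrtr_ge0.
    by apply: mulr_ge0; lra.
  have [_] := approximation_gap mA mB indA indB
    (fun ij => let: And5 (conj h _) _ _ _ _ := mom ij in h)
    (fun ij => let: And5 (conj _ h) _ _ _ _ := mom ij in h)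
    (fun ij => let: And5 _ h _ _ _ := mom ij in h)
    (fun ij => let: And5 _ _ h _ _ := mom ij in h)
    (fun ij => let: And5 _ _ _ h _ := mom ij in h)
    (fun ij => let: And5 _ _ _ _ h := mom ij in h) k0 a0 b1 apx dg dg1 dg2 gK.
  move/le_trans; apply.
  rewrite card_prod !card_ord natrM -l3 -/s.
  by apply: gap_arith ms nu6 _ tau01 M00 o0 K0 nu1 s0 L2 l2 hd mn.
- have [mV _] := value_measurable hd ho.
  have bnd (X : 'I_m -> 'I_n -> {RV P >-> R}) :
      `|\int[P]_t g (fine (Vx (fun ij => X ij.1 ij.2 t)))| <= K.
    have mg : measurable_fun setT g.
      by apply: continuous_measurable_fun; exact: has_deriv_continuous dg.
    have gb x : `|g x| <= K by have [] := gK x.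
    have mgV : measurable_fun setT (fun t => g (fine (Vx (fun ij => X ij.1 ij.2 t)))).
      apply: measurableT_comp => //.
      by apply: (mV _ _ (fun ij t => X ij.1 ij.2 t)).
    have iV := integrable_bounded P mgV (fun t => gb _).
    apply: (le_trans (le_normr_Rintegral measurableT iV)).
    have ic := finite_measure_integrable_cst P K measurableT.
    apply: (@le_trans _ _ (\int[P]_t K)).
      by apply: le_Rintegral => //; exact: integrable_norm.
    rewrite Rintegral_cst//.
    have -> : fine (P setT) = 1 by rewrite probability_setT.
    by rewrite mulr1.
  (* [b < 1] means [nu ^+ 7 * l < L ^+ 2], so [E] is at least
     [nu ^+ 6 * l ^+ 3 = n * ln (L / delta)], which is at least 1/2. The trivial bound [2 * K] is
     then affordable. *)
  have hE : 1 <= 2 * E.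
    have L20 : 0 < L ^+ 2 by rewrite exprn_gt0//; lra.
    have nu0 : 0 < nu by lra.
    rewrite /b ltr_pdivrMr// mul1r in b1.
    have : nu ^+ 7 * l * (l ^+ 2 / nu) <= L ^+ 2 * (l ^+ 2 / nu).
      by apply: ler_wpM2r; [rewrite divr_ge0 ?exprn_ge0//; lra|exact: ltW].
    rewrite (_ : nu ^+ 7 * l * (l ^+ 2 / nu) = nu ^+ 6 * l ^+ 3); last first.
      by field; rewrite gt_eqF.
    rewrite mulrA -/E => hE.
    have n61 : 1 <= nu ^+ 6 by rewrite -nu6.
    have ll : 2^-1 <= l ^+ 3.
      rewrite l3; apply: (le_trans (@ln2_ge_half R)); rewrite ler_ln ?posrE//; lra.
    have := ler_pM ler01 _ n61 ll; rewrite invr_ge0 ler0n => /(_ isT); lra.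
  apply: (@le_trans _ _ (2 * K)).
    by apply: (le_trans (ler_normB _ _)); have := bnd A0; have := bnd B0; lra.
  have C4 : 4 <= gap_cst tau M0 by case/andP: tau01 => t0 _; exact: gap_cst_ge4.
  apply: (@le_trans _ _ (4 * K * E)).
    by have := ler_wpM2l (ltW K0) hE; lra.
  apply: ler_pM => //; [by apply: mulr_ge0 => //; exact: ltW| |lra].
  by rewrite ler_wpM2r// ltW.
Qed.

(** Stated for explicit derivatives and a bound [K] instead of [Kg], so that it serves both general
    test functions and the smooth step. Meshes with infinite oscillation contribute [+oo] to the
    infimum and are harmless. *)
Lemma value_gap :
  ((`|\int[P]_t g (fine (VA t)) - \int[P]_t g (fine (VB t))|)%:E <=
   (gap_cst tau M0 * K)%:E * rate Q L)%E.
Proof.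
have CK0 : 0 < gap_cst tau M0 * K.
  case/andP: tau01 => t0 _; rewrite mulr_gt0//.
  by apply: lt_le_trans (gap_cst_ge4 _ t0).
rewrite muleC -lee_pdivrMr//. apply: le_ereal_inf_tmp => _ [delta hd <-].
have /andP[d0 d1] := delta_le1 hd.
have L2 : 2 <= L by move: Lu1 Lw1; lra.
have oge0 := osc_ge0 Q (le_trans (ler0n _ 2) L2) (ltW d0).
case ho : (osc Q L delta) oge0 => [r| |] // oge0; last by rewrite addye// leey.
rewrite lee_pdivrMr// -EFinD -EFinM lee_fin mulrC.
exact: value_gap_delta.
Qed.

End ValueGap.

(** * Test functions, degenerate cases and conclusion *)

Section RegularTestFunctions.
Context (R : realType).

Lemma C3_has_deriv (g : R -> R) (l : nat) : C3 g -> (l < 3)%N ->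
  has_deriv (derive1n l g) (derive1n l.+1 g).
Proof.
move=> [dg _] l3 x; apply: DeriveDef; first exact: dg.
by rewrite /= derive1E.
Qed.

Lemma Kg_ge1 (g : R -> R) : (1 <= Kg g)%E.
Proof. by rewrite /Kg leeDl//; exact: bigmax_ge_id. Qed.

Lemma Kg_bound (g : R -> R) (K : R) (l : 'I_4) (x : R) : Kg g = K%:E ->
  `|derive1n l g x| <= K.
Proof.
move=> gK; rewrite -lee_fin -gK /Kg.
apply: (@le_trans _ _ (sup_norm (derive1n l g))).
  by apply: ereal_sup_ubound; exists x.
apply: (@le_trans _ _ (\big[maxe/0]_(l < 4) sup_norm (derive1n l g))%E).
  exact: (le_bigmax_cond _ (fun l : 'I_4 => sup_norm (derive1n l g))).
by rewrite leeDr.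
Qed.

End RegularTestFunctions.

Lemma optimal_value_empty (R : realType) (U W : Type) (Su : set U) (Sw : set W)
    (V : (U -> W -> R) -> \bar R) F G :
  [\/ V = max_min Su Sw, V = min_max Su Sw | V = min_max_swap Su Sw] ->
  Su = set0 \/ Sw = set0 -> V F = V G.
Proof.
move=> hV [e|e]; case: hV => ->; rewrite /max_min /min_max /min_max_swap e
    ?image_set0//.
all: congr (_ _); by congr image; apply/funext => u; rewrite ?image_set0.
Qed.

Theorem corollary2p6 (R : realType) :
  exists2 c : R, 0 < c &
  forall tau M0 : R, 0 < tau < 1 ->
  exists2 C0 : R, 0 < C0 &
  forall (m n : nat), (0 < m)%N -> (0 < n)%N ->
    tau <= m%:R / n%:R <= tau^-1 ->
  forall (d : measure_display) (T : measurableType d) (P : probability T R)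
    (A0 B0 : 'I_m -> 'I_n -> {RV P >-> R}) (S : {set 'I_m * 'I_n}),
    independent_entries A0 -> independent_entries B0 ->
    standardized_off S A0 -> standardized_off S B0 ->
    max_third_moment S A0 B0 = M0%:E ->
  forall Q : 'cV[R]_m -> 'cV[R]_n -> R,
    jointly_measurable Q ->
  forall (Lu Lw : R) (Su : set 'cV[R]_m) (Sw : set 'cV[R]_n),
    1 <= Lu -> 1 <= Lw ->
    borel_set Su -> borel_set Sw ->
    Su `<=` cube Lu -> Sw `<=` cube Lw ->
  forall V : ('cV[R]_m -> 'cV[R]_n -> R) -> \bar R,
    [\/ V = max_min Su Sw, V = min_max Su Sw | V = min_max_swap Su Sw] ->
  let VA t := V (Xn Q (scaled_mx A0 t)) in
  let VB t := V (Xn Q (scaled_mx B0 t)) in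
  let r := rate Q (Lu + Lw) in
  expectation_bound P C0 r VA VB /\ tail_bound P (c * C0) r VA VB.
Proof.
(* [c] bounds the smooth step and its derivatives and is fixed before [tau] and [M0], which makes
   [c * C0] an absolute multiple of [C0]. *)
have [c c0 step] := smooth_step_scaled R.
exists c => // tau M0 tau01.
have C0 : 0 < gap_cst tau M0.
  by case/andP: tau01 => t0 _; apply: lt_le_trans (gap_cst_ge4 _ t0).
exists (gap_cst tau M0) => //.
move=> m n m0 n0 mn d T P A0 B0 S indA indB stA stB hM Q _ Lu Lw Su Sw Lu1 Lw1 _ _.
move=> SuL SwL V hV VA VB r.
have L2 : 2 <= Lu + Lw by lra.
have r0 : (0 < r)%E by exact: rate_gt0.
have [empty|nonempty] := pselect (Su = set0 \/ Sw = set0).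
  have [x hx] : exists x, (VA = fun=> x) /\ (VB = fun=> x).
    exists (V (fun _ _ => 0)); split; apply/funext => t;
      exact: optimal_value_empty hV empty.
  case: hx => -> ->; split.
  - move=> g _; rewrite expectation_cst subee// abse0.
    by rewrite !mule_ge0// ?lee_fin ?(ltW C0)// ?(ltW r0)// (le_trans _ (Kg_ge1 g)).
  - move=> z eps e0; have pos : (0 <= (c * gap_cst tau M0 * Num.max 1 (eps ^-
        3))%:E * r)%E.
      apply: mule_ge0; last exact: ltW.
      rewrite lee_fin; apply: mulr_ge0; last by rewrite le_max ler01.
      by apply: mulr_ge0; exact: ltW.
    have [h|h] := boolP ((z + 3 * eps)%:E < x)%E.
      have h' : ((z + eps)%:E < x)%E.
        by apply: le_lt_trans h; rewrite lee_fin; lra.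
      by rewrite h' leeDl.
    rewrite (_ : [set t | _] = set0); last by apply/seteqP; split.
    by rewrite measure0 adde_ge0.
have Su0 : Su !=set0 by apply/set0P/eqP => e; apply: nonempty; left.
have Sw0 : Sw !=set0 by apply/set0P/eqP => e; apply: nonempty; right.
have [roo|rfin] := eqVneq r +oo%E.
  rewrite roo; split.
  - move=> g _; rewrite gt0_muley ?leey// mule_gt0// (lt_le_trans _ (Kg_ge1 g))//.
  - move=> z eps e0; rewrite gt0_muley ?addey ?leey//.
      by rewrite -ltNye (lt_le_trans _ (measure_ge0 _ _)).
    by rewrite lte_fin !mulr_gt0// lt_max ltr01.
(* A finite rate provides a mesh with finite oscillation; hence the values are finite and
   measurable, and [fine] can be undone. *)
have [delta [hd [e ho]]] : exists delta, 0 < delta <= n%:R^-1 /\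
    exists o, osc Q (Lu + Lw) delta = o%:E.
  have : (r < +oo)%E by rewrite lt_neqAle rfin leey.
  move=> /ereal_inf_lt[_ [delta hd <-] h]; exists delta; split=> //.
  have /andP[d0 _] := hd.
  have := osc_ge0 Q (le_trans (ler0n _ 2) L2) (ltW d0).
  case: (osc Q _ _) h => [w| |] //; first by exists w.
have [mV finV] := value_measurable m0 n0 Lu1 Lw1 SuL SwL Su0 Sw0 hV hd ho.
have mVX (X : 'I_m -> 'I_n -> {RV P >-> R}) :
    measurable_fun setT (fun t => fine (V (Xn Q (scaled_mx X t)))).
  rewrite (_ : (fun t => _) = (fun t => fine (V (affine_payoff Q
    (@bilinear_coef R m n) (fun ij => X ij.1 ij.2 t))))).
    by apply: (mV _ T (fun ij t => X ij.1 ij.2 t)).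
  by apply/funext => t; rewrite Xn_scaled_mx.
have finX (X : 'I_m -> 'I_n -> {RV P >-> R}) t : V (Xn Q (scaled_mx X t)) \is a
    fin_num.
  by rewrite Xn_scaled_mx.
have gap (g g1 g2 g3 : R -> R) K := @value_gap R tau M0 m n tau01 m0 n0 mn d T P
    A0 B0 S
  indA indB stA stB hM Q Lu Lw Su Sw Lu1 Lw1 SuL SwL Su0 Sw0 V hV g g1 g2 g3 K.
have mgV (g : R -> R) (g1 : R -> R) (X : 'I_m -> 'I_n -> {RV P >->
    R}) : has_deriv g g1 ->
    measurable_fun setT (fun t => g (fine (V (Xn Q (scaled_mx X t))))).
  move=> dg; apply: measurableT_comp; last exact: mVX.
  by apply: continuous_measurable_fun; exact: has_deriv_continuous dg.
have EE (g : R -> R) g1 K (X : 'I_m -> 'I_n -> {RV P >-> R}) : has_deriv g g1 ->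
    (forall x, `|g x| <= K) ->
    (\int[P]_t (g (fine (V (Xn Q (scaled_mx X t)))))%:E =
     (\int[P]_t g (fine (V (Xn Q (scaled_mx X t)))))%R%:E)%E.
  move=> dg gK; rewrite /Rintegral fineK//.
  exact/integrable_fin_num/(integrable_bounded P (mgV g g1 X dg) (fun t => gK _)).
split.
- move=> g gC3; case gK : (Kg g) => [K| |].
  + have B l x : `|derive1n (l : 'I_4) g x| <= K by exact: Kg_bound gK.
    have K0 : 0 < K by have := Kg_ge1 g; rewrite gK lee_fin; apply: lt_le_trans.
    have d0 := C3_has_deriv gC3 (isT : 0 < 3)%N.
    have d1 := C3_has_deriv gC3 (isT : 1 < 3)%N.
    have d2 := C3_has_deriv gC3 (isT : 2 < 3)%N.
    have b0 x : `|g x| <= K by exact: (B (Ordinal (isT : 0 < 4)%N)).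
    rewrite unlock !(EE g _ K _ d0 b0) -EFinB -EFinM; apply: gap K0 d0 d1 d2 _ => x.
    by split; [exact: b0|exact: (B (Ordinal (isT : 1 < 4)%N))
      |exact: (B (Ordinal (isT : 2 < 4)%N))|exact: (B (Ordinal (isT : 3 < 4)%N))].
  + rewrite gt0_muley ?lte_fin// gt0_mulye// leey//.
  + by have := Kg_ge1 g; rewrite gK.
(* The step lies between the indicators of the half-lines above [z + 3 * eps] and above [z + eps];
   its expectations under [A] and [B] thus bracket the two tail probabilities. *)
- move=> z eps e0; have [g [g1 [g2 [g3 [[d0 [d1 d2]] gb g01 g_0 g_1]]]]] :=
      step z _ e0.
  set K := c * Num.max 1 (eps ^- 3) in gb.
  have K0 : 0 < K by rewrite mulr_gt0// lt_max ltr01.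
  have b0 x : `|g x| <= K by have [] := gb x.
  have mS (a : R) (X : 'I_m -> 'I_n -> {RV P >-> R}) :
      measurable [set t | a%:E < V (Xn Q (scaled_mx X t))]%E.
    rewrite (_ : mkset _ = (fun t => fine (V (Xn Q (scaled_mx X t)))) @^-1` `]a,
        +oo[).
      by rewrite -[_ @^-1` _]setTI; exact: mVX.
    by apply/seteqP; split=> t /=; rewrite in_itv/= andbT -lte_fin fineK.
  have mg (X : 'I_m -> 'I_n -> {RV P >-> R}) :
      measurable_fun setT (fun t => (g (fine (V (Xn Q (scaled_mx X t)))))%:E).
    exact/measurable_EFinP/(mgV g g1).
  have g0 x : 0 <= g x by have /andP[] := g01 x.
  have PE (a : R) (X : 'I_m -> 'I_n -> {RV P >-> R}) : (P [set t | a%:E < V (Xn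
      Q (scaled_mx X t))] =
      \int[P]_t (\1_[set t | (a%:E < V (Xn Q (scaled_mx X t)))%E] t)%:E)%E.
    by rewrite integral_indic ?setIT//; exact: mS.
  have lo : (P [set t | (z + 3 * eps)%:E < VA t] <= \int[P]_t (g (fine (VA t)))%:E)%E.
    rewrite PE.
    apply: ge0_le_integral => //.
    + by apply/measurable_EFinP; apply: measurable_indic; exact: mS.
    + exact: mg.
    + move=> t _; rewrite lee_fin indicE; case: (boolP (t \in _)) => [|_];
          last exact: g0.
      by rewrite inE /= => /ltW h; rewrite g_1// -lee_fin fineK// finX.
  have hi : (\int[P]_t (g (fine (VB t)))%:E <= P [set t | (z + eps)%:E < VB t])%E.
    rewrite PE.
    apply: ge0_le_integral => //.
    + by move=> t _; rewrite lee_fin.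
    + exact: mg.
    + by apply/measurable_EFinP; apply: measurable_indic; exact: mS.
    + move=> t _; rewrite lee_fin indicE; case: (boolP (t \in _)) => [_|].
        by have /andP[] := g01 (fine (VB t)).
      rewrite notin_setE /= => /negP; rewrite -leNgt => h.
      by rewrite g_0// -lee_fin fineK// finX.
  have := gap g g1 g2 g3 K K0 d0 d1 d2 gb.
  rewrite /K mulrCA mulrA => hgap.
  apply: (le_trans lo); apply: (le_trans _ (leeD hi hgap)).
  rewrite !(EE g _ K _ d0 b0) -EFinD lee_fin -lerBlDl; exact: ler_norm.
Qed.
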